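(* Let $n\ge1$, $S=\mathbb{Z}[t_1,\dots,t_n]$, specialize $t_i=0$ for $i>n$, and let $\lambda\in\mathcal{SP}(n)$. Then, in the ring $S[q][Q_1(x|t),\dots,Q_n(x|t),2Q_{n+1}(x|t),Q_{n+2}(x|t),\dots,Q_{2n}(x|t)]$, $$Q_1(x|t)Q_\lambda(x|t)\equiv\sum_{\mu\to\lambda,\ \mu\in\mathcal{SP}(n)}2^{\ell(\lambda)-\ell(\mu)+1}Q_\mu(x|t)+2\Big(\sum_{i=1}^{\ell(\lambda)}t_{\lambda_i}\Big)Q_\lambda(x|t)+q\,Q_{\lambda^-}(x|t)\mod J_n^{(q)},$$ where the last term is present only when $\lambda_1=n$, in which case $\lambda^-=(\lambda_2,\dots,\lambda_{\ell(\lambda)})$.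
   Context: $x=(x_1,x_2,\dots)$, $t=(t_1,t_2,\dots)$ indeterminates; $\Gamma'=\mathbb{Z}[P_1(x),\dots]$, $\Gamma=\mathbb{Z}[Q_1(x),\dots]$ (Schur $P$-, $Q$-functions). With $(y|t)^k=(y-t_1)\cdots(y-t_k)$ and strict $\lambda$ of length $\ell\le N$, $P_\lambda(x_1,\dots,x_N|t)=\frac{1}{(N-\ell)!}\sum_{w\in S_N}w\big(\prod_{i=1}^\ell(x_i|t)^{\lambda_i}\prod_{i=1}^\ell\prod_{j=i+1}^N\frac{x_i+x_j}{x_i-x_j}\big)$, $P_\lambda(x|t)$ is its projective limit over even $N$, and $Q_\lambda(x|t)=2^{\ell(\lambda)}P_\lambda(x|0,t_1,t_2,\dots)\in\mathbb{Z}[t]\otimes\Gamma$; $Q_i=Q_{(i)}$, $Q_\emptyset=1$. $\mathcal{SP}(n)$: strict partitions (including $\emptyset$) with $\lambda_1\le n$; $\mu\to\lambda$ means the strict partition $\mu$ is obtained from $\lambda$ by adding one box. The ring in the claim is the $S[q]$-subalgebra of $S[q]\otimes\Gamma$ generated by the listed elements, and $J_n^{(q)}$ is its ideal generated by $2Q_{n+1}(x|t)-q,Q_{n+2}(x|t),\dots,Q_{2n}(x|t)$. *)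

(* Defs.v *)
From HB Require Import structures.
From mathcomp Require Import all_boot all_order all_fingroup all_algebra.
From mathcomp Require Import mpoly.
From mathcomp Require boolp.

Set Implicit Arguments.
Unset Strict Implicit.
Unset Printing Implicit Defensive.

Import GRing.Theory.
Local Open Scope ring_scope.

(* Parameter sequences u : nat -> R are indexed from 1; u 0 is never used. *)
Definition ffact (R : pzRingType) (u : nat -> R) (y : R) (k : nat) : R :=
  \prod_(1 <= i < k.+1) (y - u i).

Section FactorialP.
Variables (K : fieldType) (u : nat -> K) (la : seq nat) (N : nat).

Definition Pterm (a : 'I_N -> K) : K :=
  (\prod_(i < N | (i < size la)%N) ffact u (a i) (nth 0%N la i)) *
  (\prod_(i < N | (i < size la)%N) \prod_(j < N | (i < j)%N)
     ((a i + a j) / (a i - a j))).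

(* P_la(a_1, ..., a_N | u), meaningful for size la <= N *)
Definition Peval (a : 'I_N -> K) : K :=
  ((N - size la)`!)%:R^-1 * \sum_(w : 'S_N) Pterm (fun i => a (w i)).

End FactorialP.

Section Restriction.
Variables (l N : nat) (le_lN : (l <= N)%N).

Definition perm_restr (w : 'S_N) : {ffun 'I_l -> 'I_N} :=
  [ffun k => w (widen_ord le_lN k)].
Definition perm_ext (f : {ffun 'I_l -> 'I_N}) : 'S_N :=
  odflt 1%g [pick w | perm_restr w == f].

Lemma restr_inj w : injectiveb (perm_restr w).
Proof.
by apply/injectiveP => i j; rewrite !ffunE => /perm_inj /(congr1 val) /= /val_inj.
Qed.

Lemma card_restr w0 : #|[pred w | perm_restr w == perm_restr w0]| = (N - l)`!.
Proof.
pose A := [set i : 'I_N | (l <= i)%N].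
have cA : #|A| = (N - l)%N.
  have -> : A = ~: [set widen_ord le_lN k | k : 'I_l].
    apply/setP => i; rewrite !inE leqNgt; congr (~~ _).
    apply/idP/imsetP => [lt_il | [k _ ->]]; last by rewrite /=.
    by exists (Ordinal lt_il) => //; apply: val_inj.
  rewrite cardsCs setCK card_imset ?card_ord //.
  by move=> i j /(congr1 val) /= /val_inj.
rewrite -cA -card_perm -(card_imset (perm_on A) (mulIg w0)).
apply: eq_card => w; rewrite inE; apply/eqP/imsetP => [eq_w|[h hA ->]].
  exists (w * w0^-1)%g; last by rewrite mulgKV.
  apply/subsetP => i; rewrite !inE permM; apply: contraR; rewrite -ltnNge => lt_il.
  move/ffunP/(_ (Ordinal lt_il)): eq_w; rewrite !ffunE.
  have -> : widen_ord le_lN (Ordinal lt_il) = i by apply: val_inj.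
  by move=> ->; rewrite permK.
apply/ffunP => k; rewrite !ffunE permM (out_perm hA) // inE -ltnNge.
exact: (ltn_ord k).
Qed.

Lemma perm_extK (f : {ffun 'I_l -> 'I_N}) : injectiveb f -> perm_restr (perm_ext f) = f.
Proof.
move=> /injectiveP inj_f; rewrite /perm_ext; case: pickP => [w /eqP //|] /= H.
pose s := codom f ++ enum [predC codom f].
have us : uniq s.
  rewrite cat_uniq enum_uniq; apply/and3P; split=> //; first exact/injectiveP.
  by apply/hasPn => x; rewrite mem_enum.
have ss : size s = N.
  rewrite size_cat -cardE.
  by move: (cardC (mem (codom f))); rewrite card_ord (card_uniqP _) //; apply/injectiveP.
have injg : injective (fun i : 'I_N => nth i s i).
  move=> i j /=; rewrite (@set_nth_default _ s i j) ?ss //.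
  by move/eqP; rewrite nth_uniq ?ss // => /eqP /val_inj.
case/negP: (negbT (H (perm injg))); apply/eqP/ffunP => k.
rewrite !ffunE permE /= nth_cat size_codom card_ord ltn_ord.
set x0 := widen_ord _ _; rewrite (nth_map k); last by rewrite size_enum_ord.
by congr (f _); rewrite nth_ord_enum.
Qed.

Lemma sum_restr (V : zmodType) (G : 'S_N -> V) :
    (forall w w', perm_restr w = perm_restr w' -> G w = G w') ->
  \sum_w G w = (\sum_(f : {ffun 'I_l -> 'I_N} | injectiveb f) G (perm_ext f)) *+ (N - l)`!.
Proof.
move=> GE; rewrite (partition_big perm_restr (fun f : {ffun 'I_l -> 'I_N} => injectiveb f)) /=; last first.
  by move=> w _; apply: restr_inj.
rewrite -sumrMnl; apply: eq_bigr => f inj_f.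
rewrite (eq_bigr (fun=> G (perm_ext f))) => [|w /eqP wf]; last first.
  by apply: GE; rewrite perm_extK.
rewrite sumr_const -(card_restr (perm_ext f)) perm_extK //.
Qed.
End Restriction.

Section Vandermonde.

Definition vdm (R : comPzRingType) (N : nat) (a : 'I_N -> R) : R :=
  \prod_(i < N) \prod_(j < N | (i < j)%N) (a i - a j).

Lemma vdm_perm (R : comPzRingType) N (a : 'I_N -> R) (w : 'S_N) :
  vdm (fun i => a (w i)) = (-1) ^+ w * vdm a.
Proof.
have E b : vdm b = \det (Vandermonde N (\row_i - b i)) :> R.
  rewrite det_Vandermonde; apply: eq_bigr => i _; apply: eq_bigr => j _.
  by rewrite !mxE opprK addrC.
rewrite !E.
have -> : Vandermonde N (\row_i - a (w i)) =
          col_perm w (Vandermonde N (\row_i - a i)).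
  by apply/matrixP => i j; rewrite !mxE.
by rewrite col_permE det_mulmx det_perm odd_permV mulrC.
Qed.

Lemma vdm_neq0 (R : idomainType) N (a : 'I_N -> R) :
  injective a -> vdm a != 0.
Proof.
move=> inj_a; apply/prodf_neq0 => i _; apply/prodf_neq0 => j lt_ij.
by rewrite subr_eq0 (inj_eq inj_a) neq_ltn lt_ij.
Qed.

Lemma rmorph_vdm (R S : comPzRingType) (f : {rmorphism R -> S}) N
    (a : 'I_N -> R) : f (vdm a) = vdm (fun i => f (a i)).
Proof.
rewrite rmorph_prod; apply: eq_bigr => i _; rewrite rmorph_prod.
by apply: eq_bigr => j _; rewrite rmorphB.
Qed.

Lemma rmorph_mmap (R : nzRingType) (S S' : comNzRingType)
    (g : {rmorphism S -> S'}) (f : {rmorphism R -> S}) (N : nat)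
    (h : 'I_N -> S) (p : {mpoly R[N]}) :
  g (mmap f h p) = mmap (g \o f) (g \o h) p.
Proof.
rewrite /mmap rmorph_sum; apply: eq_bigr => m _; rewrite rmorphM; congr (_ * _).
by rewrite /mmap1 rmorph_prod; apply: eq_bigr => i _; rewrite rmorphXn.
Qed.

Lemma eq_mmap (R S : nzRingType) (f g : R -> S) (N : nat) (h k : 'I_N -> S)
    (p : {mpoly R[N]}) : f =1 g -> h =1 k -> mmap f h p = mmap g k p.
Proof.
move=> fg hk; apply: eq_bigr => m _; rewrite fg /mmap1; congr (_ * _).
by apply: eq_bigr => i _; rewrite hk.
Qed.

Lemma mmap_id (R : nzRingType) (N : nat) (p : {mpoly R[N]}) :
  mmap (@mpolyC N R) (fun i => 'X_i) p = p.
Proof.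
rewrite [RHS]mpolyE; apply: eq_bigr => m _; rewrite mul_mpolyC.
by rewrite mpolyXE_id.
Qed.

Lemma mmapXU (R S : nzRingType) (f : {rmorphism R -> S}) (N : nat)
    (h : 'I_N -> S) (i : 'I_N) : mmap f h 'X_i = h i.
Proof. by rewrite mmapX mmap1U. Qed.

Lemma mpolyXU_inj (R : nzRingType) (N : nat) :
  injective (fun i : 'I_N => 'X_i : {mpoly R[N]}).
Proof.
move=> i j /(congr1 (fun p : {mpoly R[N]} => p@_U_(j))); rewrite /= !mcoeffXU eqxx.
by case: eqP => // _ /eqP; rewrite eq_sym oner_eq0.
Qed.

Variables (R : idomainType) (N : nat).
Implicit Types p : {mpoly R[N]}.

Definition msubst (i j : 'I_N) : {mpoly R[N]} -> {mpoly R[N]} :=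
  mmap (@mpolyC N R) (fun k => 'X_(if k == i then j else k)).

Lemma msubst_dvd (i j : 'I_N) p :
  exists B, p - msubst i j p = ('X_i - 'X_j) * B.
Proof.
pose D p := exists B, p - msubst i j p = ('X_i - 'X_j) * B.
have D1 : D 1 by exists 0; rewrite /msubst rmorph1 subrr mulr0.
have DM p1 p2 : D p1 -> D p2 -> D (p1 * p2).
  move=> [B1 E1] [B2 E2]; exists (B1 * p2 + msubst i j p1 * B2).
  rewrite mulrDr mulrA -E1 mulrCA -E2 mulrBl mulrBr /msubst rmorphM /=.
  by rewrite addrA subrK.
rewrite -/(D p); move: p; apply: mpolyind => [|c m p _ _ [B2 E2]].
  by exists 0; rewrite /msubst rmorph0 subrr mulr0.
suff [B1 E1] : D (c *: 'X_[m]).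
  exists (B1 + B2); rewrite mulrDr -E1 -E2 /msubst rmorphD /=.
  by rewrite opprD addrACA.
rewrite -mul_mpolyC; apply: (DM).
  by exists 0; rewrite /msubst mmapC subrr mulr0.
rewrite mpolyXE_id; refine (@big_ind _ D _ _ D1 DM _ _ _ _ _) => k _.
elim: (m k) => [|e IHe]; rewrite ?expr0 // exprS; apply: (DM) => //.
rewrite /D /msubst mmapXU; case: (k =P i) => [->|_]; first by exists 1; rewrite mulr1.
by exists 0; rewrite subrr mulr0.
Qed.

Lemma vdm_dvd (A : {mpoly R[N]}) :
    (forall i j : 'I_N, (i < j)%N -> msubst i j A = 0) ->
  exists B, A = vdm (fun i => 'X_i) * B.
Proof.
move=> A0.
have -> : vdm (fun i : 'I_N => 'X_i : {mpoly R[N]}) =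
    \prod_(p <- enum [pred p : 'I_N * 'I_N | (p.1 < p.2)%N]) ('X_p.1 - 'X_p.2).
  by rewrite /vdm pair_big_dep /= big_enum.
set s := enum _; have us : uniq s by apply: enum_uniq.
have ls (p : 'I_N * 'I_N) : p \in s -> (p.1 < p.2)%N by rewrite mem_enum.
elim: s us ls => [|[i j] s IHs] /=.
  by exists A; rewrite big_nil mul1r.
move=> /andP[ns us] ls.
have [|B AE] := IHs us; first by move=> p ps; apply: ls; rewrite inE ps orbT.
have lt_ij : (i < j)%N by apply: (ls (i, j)); rewrite inE eqxx.
have [C BE] := msubst_dvd i j B.
suff B0 : msubst i j B = 0.
  by exists C; rewrite big_cons mulrAC -BE B0 subr0 mulrC -AE.
move: (A0 i j lt_ij); rewrite AE /msubst rmorphM /= => /eqP; rewrite mulf_eq0.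
case/orP => [|/eqP //]; rewrite rmorph_prod /= big_seq prodf_seq_eq0.
case/hasP => -[k l] /= kls; rewrite kls /= rmorphB /= !mmapXU subr_eq0.
rewrite (inj_eq (@mpolyXU_inj _ _)) => /eqP klE.
have lt_kl : (k < l)%N by apply: (ls (k, l)); rewrite inE kls orbT.
have nij : (k, l) != (i, j) by apply: contraNneq ns => <-.
exfalso; move: klE nij lt_kl lt_ij; rewrite xpair_eqE.
case: (k =P i) => [->|_]; case: (l =P i) => [->|_] /=.
- by rewrite ltnn.
- by move=> ->; rewrite eqxx.
- by move=> -> _ lt1 lt2; move: (ltn_trans lt1 lt2); rewrite ltnn.
- by move=> ->; rewrite ltnn.
Qed.

End Vandermonde.

Definition widen2 (N : nat) (i : 'I_N) : 'I_N.+2 :=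
  widen_ord (leqnSn N.+1) (widen_ord (leqnSn N) i).

Section PevalTheory.
Variables (K : fieldType) (u : nat -> K) (la : seq nat).
Local Notation l := (size la).

Definition Pratio (N : nat) (a : 'I_N -> K) i j := (a i + a j) / (a i - a j).

(* The summand of P_la attached to an injection {1..l} -> {1..N}. *)
Definition Pinj (N : nat) (a : 'I_N -> K) (f : 'I_l -> 'I_N) : K :=
  (\prod_(k < l) ffact u (a (f k)) (nth 0%N la k)) *
  \prod_(k < l)
     ((\prod_(m < l | (k < m)%N) Pratio a (f k) (f m)) *
      \prod_(j | j \notin codom f) Pratio a (f k) j).

Lemma PtermE (N : nat) (le_lN : (l <= N)%N) (a : 'I_N -> K) (w : 'S_N) :
  Pterm u la (fun i => a (w i)) = Pinj a (perm_restr le_lN w).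
Proof.
rewrite /Pterm /Pinj !(big_ord_narrow le_lN); congr (_ * _).
  by apply: eq_bigr => k _; rewrite ffunE.
apply: eq_bigr => k _; rewrite (bigID (fun j : 'I_N => (j < l)%N)) /=.
congr (_ * _).
  rewrite (big_ord_narrow_cond le_lN (P := fun j : 'I_N => (k < j)%N)) /=.
  by apply: eq_bigr => m _; rewrite !ffunE.
rewrite [RHS](reindex_inj (@perm_inj _ w)) /=; apply: eq_big => [j|j _].
  rewrite -leqNgt; apply/andP/idP => [[_ le_lj]|].
    apply/negP => /codomP[m]; rewrite ffunE => /perm_inj jE.
    by move: le_lj; rewrite jE leqNgt /= ltn_ord.
  move=> nj; suff le_lj : (l <= j)%N by rewrite (leq_trans (ltn_ord k)).
  rewrite leqNgt; apply: contra nj => lt_jl; apply/codomP.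
  by exists (Ordinal lt_jl); rewrite ffunE; congr (w _); apply: val_inj.
by rewrite /Pratio ffunE.
Qed.

Lemma PevalE (N : nat) (a : 'I_N -> K) : (l <= N)%N ->
    ((N - l)`!)%:R != 0 :> K ->
  Peval u la a =
  \sum_(f : {ffun 'I_l -> 'I_N} | injectiveb f) Pinj a f.
Proof.
move=> le_lN nz; rewrite /Peval (sum_restr (le_lN := le_lN)).
  rewrite -[X in _ * X]mulr_natl mulKf //; apply: eq_bigr => f inj_f.
  by rewrite PtermE perm_extK.
by move=> w w' E; rewrite !PtermE E.
Qed.

Lemma Pinj_stable (N : nat) (a : 'I_N.+2 -> K) : injective a ->
    a ord_max = - a (widen_ord (leqnSn _) ord_max) ->
  \sum_(f : {ffun 'I_l -> 'I_N.+2} | injectiveb f) Pinj a f =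
  \sum_(f : {ffun 'I_l -> 'I_N} | injectiveb f)
     Pinj (fun i => a (widen2 i)) f.
Proof.
move=> inj_a aE; pose wd := @widen2 N.
have inj_wd : injective wd by move=> i j /(congr1 val) /= /val_inj.
pose al := widen_ord (leqnSn N.+1) (@ord_max N).
pose be := @ord_max N.+1.
pose h (g : {ffun 'I_l -> 'I_N}) : {ffun 'I_l -> 'I_N.+2} :=
  [ffun k => wd (g k)].
have inj_h : injective h.
  by move=> g g' /ffunP E; apply/ffunP => k; move: (E k); rewrite !ffunE => /inj_wd.
rewrite (bigID (fun f : {ffun 'I_l -> 'I_N.+2} => [forall k, (f k < N)%N])) /=.
rewrite [X in _ + X]big1 ?addr0; last first.
  move=> f /andP[/injectiveP inj_f]; rewrite negb_forall => /existsP[k].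
  rewrite -leqNgt => le_Nf.
  suff: exists2 c : 'I_N.+2, c != f k & a (f k) + a c = 0.
    case=> c ncf c0; rewrite /Pinj; apply/eqP; rewrite mulf_eq0; apply/orP; right.
    have r0 i j : a i + a j = 0 -> Pratio a i j = 0.
      by move=> ij; rewrite /Pratio ij mul0r.
    case: (boolP (c \in codom f)) => [/codomP[m cE]|nc]; last first.
      by rewrite (bigD1 k) //= [X in _ * X * _](bigD1 c) //= r0 // !(mul0r, mulr0).
    have nmk : m != k by apply: contraNneq ncf => <-; rewrite cE.
    case: (ltngtP k m) => [lt_km|lt_mk|/val_inj E].
    - rewrite (bigD1 k) //= [X in X * _ * _](bigD1 m) //= r0 -?cE //.
      by rewrite !(mul0r, mulr0).
    - rewrite (bigD1 m) //= [X in X * _ * _](bigD1 k) //= r0 -?cE 1?addrC //.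
      by rewrite !(mul0r, mulr0).
    - by rewrite E eqxx in nmk.
  have := ltn_ord (f k); rewrite ltnS leq_eqVlt ltnS => /orP[/eqP fE|ltf].
    exists al; first by rewrite -val_eqE /= fE neq_ltn ltnSn.
    have -> : f k = be by apply: val_inj.
    by rewrite aE addNr.
  exists be; first by rewrite -val_eqE /= neq_ltn ltnS ltf orbT.
  have -> : f k = al by apply: val_inj; apply/eqP; rewrite eqn_leq ltf.
  by rewrite aE addrN.
transitivity (\sum_(f in h @: [set g : {ffun 'I_l -> 'I_N} | injectiveb g]) Pinj a f).
  apply: eq_bigl => f; apply/andP/imsetP => [[inj_f /forallP ltf]|[g gI ->]].
    pose g : {ffun 'I_l -> 'I_N} := [ffun k => Ordinal (ltf k)].
    have fE : f = h g by apply/ffunP => k; rewrite !ffunE; apply: val_inj.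
    exists g => //; rewrite inE; apply/injectiveP => i j gij.
    by apply: (injectiveP _ inj_f); rewrite fE ffunE [RHS]ffunE gij.
  move: gI; rewrite inE => /injectiveP inj_g; split.
    by apply/injectiveP => i j; rewrite !ffunE => /inj_wd /inj_g.
  by apply/forallP => k; rewrite ffunE /=.
rewrite big_imset /=; last by move=> ? ? _ _; apply: inj_h.
apply: eq_big => [g|g _]; first by rewrite inE.
rewrite /Pinj; congr (_ * _); first by apply: eq_bigr => k _; rewrite ffunE.
apply: eq_bigr => k _; congr (_ * _).
  by apply: eq_bigr => m _; rewrite /Pratio !ffunE.
have nc (c : 'I_N.+2) : (N <= c)%N -> c \notin codom (h g).
  by move=> le_Nc; apply/codomP => -[m cE]; move: le_Nc; rewrite cE ffunE leqNgt /= ltn_ord.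
rewrite big_mkcond 2!big_ord_recr /= !nc //= [RHS]big_mkcond /= -mulrA.
rewrite [X in _ * X](_ : _ = 1) ?mulr1.
  apply: eq_bigr => j _; rewrite /Pratio ffunE.
  suff -> : (wd j \in codom (h g)) = (j \in codom g) by [].
  by apply/codomP/codomP => -[m mE]; exists m; move: mE; rewrite ffunE ?inj_wd //;
    [move/inj_wd | move=> ->].
rewrite /Pratio ffunE aE opprK -/al mulf_div [X in X / _]mulrC divff //.
have nal : a (wd (g k)) != a al.
  by rewrite (inj_eq inj_a) -val_eqE /= neq_ltn ltn_ord.
have nbe : a (wd (g k)) != a be.
  by rewrite (inj_eq inj_a) -val_eqE /= neq_ltn ltnW // ltnS ltn_ord.
by rewrite mulf_neq0 ?subr_eq0 // -[a al]opprK -aE subr_eq0.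
Qed.

End PevalTheory.

Section Polynomiality.
Variables (R : idomainType) (R0 : forall k, k.+1%:R != 0 :> R).
Variables (u : nat -> R) (la : seq nat).
Local Notation l := (size la).

Definition Pnum (S : comNzRingType) (v : nat -> S) (N : nat) (a : 'I_N -> S) : S :=
  (\prod_(i < N | (i < l)%N) ffact v (a i) (nth 0%N la i)) *
  \prod_(i < N) \prod_(j < N | (i < j)%N)
    (if (i < l)%N then a i + a j else a i - a j).

Lemma Pnum_vdm (K : fieldType) (v : nat -> K) (N : nat) (a : 'I_N -> K) :
  injective a -> Pnum v a = Pterm v la a * vdm a.
Proof.
move=> inj_a; rewrite /Pnum /Pterm -mulrA; congr (_ * _).
rewrite [X in X * _]big_mkcond -big_split /=; apply: eq_bigr => i _.
case: ifP => lt_il; last by rewrite mul1r.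
rewrite -big_split /=; apply: eq_bigr => j lt_ij; rewrite divfK //.
by rewrite subr_eq0 (inj_eq inj_a) neq_ltn lt_ij.
Qed.

Lemma rmorph_Pnum (S S' : comNzRingType) (g : {rmorphism S -> S'})
    (v : nat -> S) (N : nat) (a : 'I_N -> S) :
  g (Pnum v a) = Pnum (g \o v) (g \o a).
Proof.
rewrite /Pnum rmorphM !rmorph_prod; congr (_ * _);
  apply: eq_bigr => i _.
  by rewrite rmorph_prod; apply: eq_bigr => j _; rewrite rmorphB.
rewrite rmorph_prod; apply: eq_bigr => j _.
by case: ifP => _; [rewrite rmorphD | rewrite rmorphB].
Qed.

Lemma eq_Pnum (S : comNzRingType) (v v' : nat -> S) (N : nat) (a a' : 'I_N -> S) :
  v =1 v' -> a =1 a' -> Pnum v a = Pnum v' a'.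
Proof.
move=> vE aE; rewrite /Pnum; congr (_ * _);
  apply: eq_bigr => i _.
  by apply: eq_bigr => j _; rewrite vE aE.
by apply: eq_bigr => j _; rewrite !aE.
Qed.

Lemma mpoly_char0 (N k : nat) : k.+1%:R != 0 :> {mpoly R[N]}.
Proof. by rewrite -mpolyC_nat mpolyC_eq0. Qed.

Lemma frac_char0 (N k : nat) : k.+1%:R != 0 :> {fraction {mpoly R[N]}}.
Proof. by rewrite -tofracMn tofrac_eq0 mpoly_char0. Qed.

Lemma P_polynomial (N : nat) : (l <= N)%N ->
  exists p : {mpoly R[N]},
  forall (K : fieldType) (g : {rmorphism R -> K}) (a : 'I_N -> K),
    ((N - l)`!)%:R != 0 :> K -> injective a ->
  mmap g a p = Peval (g \o u) la a.
Proof.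
move=> le_lN.
pose G (w : 'S_N) : {mpoly R[N]} :=
  (-1) ^+ w * Pnum (fun k => (u k)%:MP) (fun i => 'X_(w i)).
have GE (K : fieldType) (g : {rmorphism R -> K}) (a : 'I_N -> K) w :
    injective a -> mmap g a (G w) = Pterm (g \o u) la (fun i => a (w i)) * vdm a.
  move=> inj_a; rewrite /G rmorphM rmorphXn rmorphN1 rmorph_Pnum /=.
  rewrite (eq_Pnum (v' := g \o u) (a' := fun i => a (w i))); last first.
  - by move=> i /=; rewrite mmapXU.
  - by move=> k /=; rewrite mmapC.
  rewrite Pnum_vdm; last exact: (inj_comp inj_a perm_inj).
  by rewrite vdm_perm mulrCA [X in _ * X]mulrA -signr_odd -expr2 sqrr_sign mul1r.
pose Gf (N : nat) : {rmorphism R -> {fraction {mpoly R[N]}}} :=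
  (@tofrac {mpoly R[N]}) \o (@mpolyC N R).
have XfI : injective (fun i : 'I_N => tofrac ('X_i : {mpoly R[N]})).
  by move=> i j /eqP; rewrite tofrac_eq => /eqP /mpolyXU_inj.
have toE (p : {mpoly R[N]}) : tofrac p = mmap (Gf N) (fun i => tofrac 'X_i) p.
  by rewrite -[in LHS](mmap_id p) rmorph_mmap.
have Gr w w' : perm_restr le_lN w = perm_restr le_lN w' -> G w = G w'.
  move=> E; apply/eqP; rewrite -tofrac_eq !toE !GE //; apply/eqP; congr (_ * _).
  rewrite (PtermE _ le_lN (fun i => tofrac 'X_i)) E.
  by rewrite -(PtermE _ le_lN (fun i => tofrac 'X_i)).
pose A : {mpoly R[N]} :=
  \sum_(f : {ffun 'I_l -> 'I_N} | injectiveb f) G (perm_ext le_lN f).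
have [B AE] : exists B, A = vdm (fun i => 'X_i) * B.
  apply: vdm_dvd => i j lt_ij.
  suff: msubst i j (A *+ (N - l)`!) = 0.
    rewrite /msubst rmorphMn /= => /eqP; rewrite -mulr_natr mulf_eq0.
    by rewrite -(prednK (fact_gt0 _)) (negbTE (mpoly_char0 _ _)) orbF => /eqP.
  rewrite -(sum_restr Gr); set s := msubst i j _.
  suff sN : s = - s.
    move/eqP: sN; rewrite -addr_eq0 -mulr2n -mulr_natr mulf_eq0.
    by rewrite (negbTE (mpoly_char0 _ _)) orbF => /eqP.
  have sG w : msubst i j (G w) = (-1) ^+ w * Pnum (fun k => (u k)%:MP)
      (fun k => 'X_(if w k == i then j else w k)) :> {mpoly R[N]}.
    rewrite /msubst /G rmorphM rmorphXn rmorphN1 rmorph_Pnum; congr (_ * _).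
    by apply: eq_Pnum => k /=; rewrite ?mmapC ?mmapXU.
  rewrite {1}/s (reindex_inj (mulIg (tperm i j))) /s /msubst !rmorph_sum /=.
  rewrite -sumrN; apply: eq_bigr => w _; rewrite -/(msubst _ _ _) sG.
  rewrite odd_permM odd_tperm -val_eqE /= neq_ltn lt_ij addbT signrN mulNr.
  rewrite -/(msubst _ _ _) sG; congr (- (_ * _)); apply: eq_Pnum => k //=.
  rewrite permM; congr ('X_ _).
  by case: (tpermP i j (w k)) => [->|->|//]; rewrite ?eqxx ?if_same //; case: eqP.
exists B => K g a nz inj_a; apply: (mulfI (vdm_neq0 inj_a)).
have -> : vdm a = mmap g a (vdm (fun i => 'X_i)).
  rewrite rmorph_vdm; apply: eq_bigr => i _; apply: eq_bigr => j _ /=.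
  by rewrite !mmapXU.
rewrite -[LHS]rmorphM -AE rmorph_vdm rmorph_sum /= PevalE // mulr_sumr.
apply: eq_bigr => f inj_f; rewrite GE // (PtermE _ le_lN) perm_extK // mulrC.
congr (_ * _); apply: eq_bigr => i _; apply: eq_bigr => j _ /=.
by rewrite !mmapXU.
Qed.

End Polynomiality.

Section ProjectiveLimit.
Variable R : comNzRingType.

(* x_{N+1} = x_{N+2} = 0 *)
Definition trunc (N : nat) (p : {mpoly R[N.+2]}) : {mpoly R[N]} :=
  mmap (@mpolyC N R)
    (fun i => if insub (val i) is Some j then 'X_j else 0) p.

Lemma trunc_add N : {morph @trunc N : p q / p + q}.
Proof. exact: rmorphD. Qed.

Lemma trunc_opp N : {morph @trunc N : p / - p}.
Proof. exact: rmorphN. Qed.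

Lemma trunc_mul N : {morph @trunc N : p q / p * q}.
Proof. exact: rmorphM. Qed.

Lemma truncC N c : @trunc N c%:MP = c%:MP.
Proof. exact: mmapC. Qed.

(* The limit of R[x_1, ..., x_N] over even N = 2m. No bound is put on the degree
   and no symmetry is imposed, so plim R contains the tensor product of R and
   Gamma as an R-subalgebra; subalgebras generated by elements of the latter, and
   ideals of those subalgebras, are the same whether formed there or in plim R. *)
Record plim : Type := PLim {
  plim_val :> forall m : nat, {mpoly R[m.*2]};
  plim_trunc : forall m, trunc (plim_val m.+1) = plim_val m }.

Lemma plimP (f g : plim) : (forall m, f m = g m) -> f = g.
Proof.
case: f g => [f fP] [g gP] /= E.
have {}E : f = g by apply: boolp.functional_extensionality_dep.
by move: fP gP; rewrite E => fP gP; congr PLim; apply: boolp.Prop_irrelevance.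
Qed.

HB.instance Definition _ := boolp.gen_eqMixin plim.
HB.instance Definition _ := boolp.gen_choiceMixin plim.

Fact plim_zero_subproof m : @trunc m.*2 0 = 0.
Proof. exact: rmorph0. Qed.
Definition plim_zero := PLim plim_zero_subproof.

Fact plim_one_subproof m : @trunc m.*2 1 = 1.
Proof. exact: rmorph1. Qed.
Definition plim_one := PLim plim_one_subproof.

Fact plim_opp_subproof (f : plim) m : trunc (- f m.+1) = - f m.
Proof. by rewrite trunc_opp plim_trunc. Qed.
Definition plim_opp f := PLim (plim_opp_subproof f).

Fact plim_add_subproof (f g : plim) m : trunc (f m.+1 + g m.+1) = f m + g m.
Proof. by rewrite trunc_add !plim_trunc. Qed.
Definition plim_add f g := PLim (plim_add_subproof f g).

Fact plim_mul_subproof (f g : plim) m : trunc (f m.+1 * g m.+1) = f m * g m.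
Proof. by rewrite trunc_mul !plim_trunc. Qed.
Definition plim_mul f g := PLim (plim_mul_subproof f g).

Fact plim_scale_subproof c (f : plim) m : trunc (c *: f m.+1) = c *: f m.
Proof. by rewrite -mul_mpolyC trunc_mul truncC plim_trunc mul_mpolyC. Qed.
Definition plim_scale c f := PLim (plim_scale_subproof c f).

Fact plim_addA : associative plim_add.
Proof. by move=> f g h; apply: plimP => m; apply: addrA. Qed.
Fact plim_addC : commutative plim_add.
Proof. by move=> f g; apply: plimP => m; apply: addrC. Qed.
Fact plim_add0 : left_id plim_zero plim_add.
Proof. by move=> f; apply: plimP => m; apply: add0r. Qed.
Fact plim_addN : left_inverse plim_zero plim_opp plim_add.
Proof. by move=> f; apply: plimP => m; apply: addNr. Qed.

HB.instance Definition _ :=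
  GRing.isZmodule.Build plim plim_addA plim_addC plim_add0 plim_addN.

Fact plim_mulA : associative plim_mul.
Proof. by move=> f g h; apply: plimP => m; apply: mulrA. Qed.
Fact plim_mulC : commutative plim_mul.
Proof. by move=> f g; apply: plimP => m; apply: mulrC. Qed.
Fact plim_mul1 : left_id plim_one plim_mul.
Proof. by move=> f; apply: plimP => m; apply: mul1r. Qed.
Fact plim_mulD : left_distributive plim_mul +%R.
Proof. by move=> f g h; apply: plimP => m; apply: mulrDl. Qed.
Fact plim_one_neq0 : plim_one != 0.
Proof.
by apply/eqP => /(congr1 (fun f : plim => f 0%N)) /eqP; apply/negP; apply: oner_neq0.
Qed.

HB.instance Definition _ := GRing.Zmodule_isComNzRing.Build plim
  plim_mulA plim_mulC plim_mul1 plim_mulD plim_one_neq0.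

Fact plim_scaleA a b f : plim_scale a (plim_scale b f) = plim_scale (a * b) f.
Proof. by apply: plimP => m; apply: scalerA. Qed.
Fact plim_scale1 : left_id 1 plim_scale.
Proof. by move=> f; apply: plimP => m; apply: scale1r. Qed.
Fact plim_scaleDr : right_distributive plim_scale +%R.
Proof. by move=> c f g; apply: plimP => m; apply: scalerDr. Qed.
Fact plim_scaleDl f : {morph plim_scale^~ f : a b / a + b}.
Proof. by move=> a b; apply: plimP => m; apply: scalerDl. Qed.

HB.instance Definition _ := GRing.Zmodule_isLmodule.Build R plim
  plim_scaleA plim_scale1 plim_scaleDr plim_scaleDl.

Fact plim_scaleAl (c : R) (f g : plim) : c *: (f * g) = (c *: f) * g.
Proof. by apply: plimP => m; apply: scalerAl. Qed.

HB.instance Definition _ := GRing.Lmodule_isLalgebra.Build R plim plim_scaleAl.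
HB.instance Definition _ := GRing.Lalgebra_isComAlgebra.Build R plim.

End ProjectiveLimit.

Section FactorialPFunction.
Variables (R : idomainType) (R0 : forall k, k.+1%:R != 0 :> R).

(* P_la(x_1, ..., x_N | u) as a rational function. For N < size la the defining
   formula does not apply and the image of P_la in N variables is 0. *)
Definition P_frac (u : nat -> R) (la : seq nat) (N : nat) :
    {fraction {mpoly R[N]}} :=
  if (size la <= N)%N then
    Peval (fun k => tofrac (u k)%:MP) la (fun i : 'I_N => tofrac 'X_i)
  else 0.

Definition P_spec (u : nat -> R) la N (p : {mpoly R[N]}) :=
  if (size la <= N)%N then
    forall (K : fieldType) (g : {rmorphism R -> K}) (a : 'I_N -> K),
    ((N - size la)`!)%:R != 0 :> K -> injective a ->
    mmap g a p = Peval (g \o u) la a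
  else p = 0.

Lemma P_specP u la N : exists p, @P_spec u la N p.
Proof.
rewrite /P_spec; case: leqP => [le_lN|_]; last by exists 0.
exact: (P_polynomial R0).
Qed.

Lemma P_spec_frac u la N p : @P_spec u la N p -> tofrac p = P_frac u la N.
Proof.
rewrite /P_spec /P_frac; case: leqP => [le_lN H|_ ->]; last exact: tofrac0.
rewrite -[in LHS](mmap_id p) rmorph_mmap.
rewrite (H _ (@tofrac {mpoly R[N]} \o @mpolyC N R)) //.
  by rewrite -(prednK (fact_gt0 _)); apply: frac_char0.
by move=> i j /eqP; rewrite tofrac_eq => /eqP /mpolyXU_inj.
Qed.

Lemma P_frac_polynomial u la N :
  exists p : {mpoly R[N]}, tofrac p == P_frac u la N.
Proof. by have [p /P_spec_frac <-] := P_specP u la N; exists p. Qed.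

Definition P_poly u la N : {mpoly R[N]} := xchoose (P_frac_polynomial u la N).

Lemma tofrac_P_poly u la N : tofrac (P_poly u la N) = P_frac u la N.
Proof. by apply/eqP; apply: (xchooseP (P_frac_polynomial u la N)). Qed.

Lemma P_polyP u la N : P_spec u la (P_poly u la N).
Proof.
have [p pP] := P_specP u la N; suff -> : P_poly u la N = p by [].
by apply/eqP; rewrite -tofrac_eq tofrac_P_poly (P_spec_frac pP).
Qed.

Lemma P_poly_trunc u la N : trunc (P_poly u la N.+2) = P_poly u la N.
Proof.
pose S := {mpoly R[N.+1]}; pose K := {fraction S}.
pose x : 'I_N.+2 -> S := fun i =>
  if insub (val i) is Some j then 'X_j else - 'X_ord_max.
pose y : 'I_N -> S := fun i => 'X_(widen_ord (leqnSn N) i).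
pose g : {rmorphism R -> K} := @tofrac S \o @mpolyC N.+1 R.
have K0 k : k.+1%:R != 0 :> K by apply: frac_char0.
have Kf k : k`!%:R != 0 :> K by rewrite -(prednK (fact_gt0 _)).
have xw (i : 'I_N) : x (widen2 i) = y i.
  rewrite /x; case: insubP => [j _ jE|]; last by rewrite /= ltnS ltnW.
  by congr ('X_ _); apply: val_inj.
have xm : x ord_max = - 'X_ord_max by rewrite /x insubF //= ltnn.
have xm1 : x (widen_ord (leqnSn _) ord_max) = 'X_ord_max.
  rewrite /x; case: insubP => [j _ jE|]; last by rewrite /= ltnSn.
  by congr ('X_ _); apply: val_inj.
have nX i : 'X_i <> - 'X_ord_max :> S.
  move/(congr1 (fun p : S => p@_U_(ord_max))); rewrite mcoeffN !mcoeffXU eqxx.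
  move/eqP; rewrite -addr_eq0 -natrD addn1.
  by rewrite (negbTE (R0 _)).
have lastE (i : 'I_N.+2) : ~~ (i < N.+1)%N -> i = N.+1 :> nat.
  by rewrite -leqNgt => le_Ni; apply/eqP; rewrite eqn_leq le_Ni -ltnS ltn_ord.
have inj_x : injective x.
  move=> i j; rewrite /x; case: insubP => [i' _ iE|ni]; case: insubP => [j' _ jE|nj].
  - by move/mpolyXU_inj => ij; apply: val_inj; rewrite -iE -jE ij.
  - by move/nX.
  - by move/esym/nX.
  - by move=> _; apply: val_inj; rewrite /= (lastE i ni) (lastE j nj).
have inj_y : injective y.
  by move=> i j /mpolyXU_inj /(congr1 val) /= /val_inj.
have inj_tx : injective (@tofrac S \o x).
  by move=> i j /= /eqP; rewrite tofrac_eq => /eqP /inj_x.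
have inj_ty : injective (@tofrac S \o y).
  by move=> i j /= /eqP; rewrite tofrac_eq => /eqP /inj_y.
have E : mmap (@mpolyC N.+1 R) x (P_poly u la N.+2) =
         mmap (@mpolyC N.+1 R) y (P_poly u la N).
  apply/eqP; rewrite -tofrac_eq !rmorph_mmap -/g; apply/eqP.
  have := P_polyP u la N.+2; have := P_polyP u la N; rewrite /P_spec.
  case: leqP => [le_lN HN|lt_Nl ->].
    have le2 : (size la <= N.+2)%N by rewrite !leqW.
    rewrite le2 => HN2; rewrite (HN _ g) // (HN2 _ g) // PevalE // PevalE //.
    rewrite Pinj_stable //=; last by rewrite xm xm1 tofracN.
    apply: eq_bigr => f _; congr Pinj; apply: boolp.functional_extensionality_dep => i.
    by rewrite /= xw.
  rewrite rmorph0; case: leqP => [le_lN2 HN2|_ ->]; last by rewrite rmorph0.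
  rewrite (HN2 _ g) // PevalE // Pinj_stable //=; last by rewrite xm xm1 tofracN.
  apply: big1 => f /injectiveP /leq_card; rewrite !card_ord leqNgt.
  by rewrite lt_Nl.
pose z : 'I_N.+1 -> {mpoly R[N]} := fun i =>
  if insub (val i) is Some j then 'X_j else 0.
move/(congr1 (mmap (@mpolyC N R) z)): E; rewrite !rmorph_mmap.
have C1 : mmap (@mpolyC N R) z \o @mpolyC N.+1 R =1 @mpolyC N R.
  by move=> c /=; rewrite mmapC.
have zm : z ord_max = 0 by rewrite /z insubF //= ltnn.
rewrite (eq_mmap _ C1 (k := fun i => if insub (val i) is Some j then 'X_j else 0)).
  rewrite (eq_mmap _ C1 (k := fun i => 'X_i)) ?mmap_id // => i /=.
  rewrite /y mmapXU /z; case: insubP => [j _ jE|]; last by rewrite /= ltn_ord.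
  by congr ('X_ _); apply: val_inj.
move=> i /=; rewrite /x; case: insubP => [j _ jE|ni].
  by rewrite mmapXU /z jE.
rewrite rmorphN /= mmapXU zm oppr0 insubF //; apply: contraNF ni => /= lt_i.
exact: ltnW.
Qed.

(* P_la(x | u) *)
Definition P_fun (u : nat -> R) (la : seq nat) : plim R :=
  @PLim R (fun m => P_poly u la m.*2) (fun m => P_poly_trunc u la m.*2).

(* (0, u_1, u_2, ...) *)
Definition cons0 (u : nat -> R) (k : nat) : R :=
  if k is k'.+2 then u k'.+1 else 0.

End FactorialPFunction.

(* S[q], with S = Z[t_1, ..., t_n] *)
Notation Sq n := {poly {mpoly int[n]}}.

Section FactorialQ.
Variable n : nat.
Local Notation R := (Sq n).

Fact Sq_char0 k : k.+1%:R != 0 :> R.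
Proof. by rewrite -polyC_natr polyC_eq0 -mpolyC_nat mpolyC_eq0 natz. Qed.

(* t_k, with t_k = 0 for k > n *)
Definition tvar (k : nat) : R :=
  if k is k'.+1 then
    if insub k' is Some i then ('X_i)%:P else 0
  else 0.

Definition qvar : R := 'X.

(* Q_la(x | t) *)
Definition Q_fun (la : seq nat) : plim R :=
  2%:R ^+ size la *: P_fun Sq_char0 (cons0 tvar) la.

Lemma Q_fun_nil : Q_fun [::] = 1.
Proof.
rewrite /Q_fun expr0 scale1r; apply: plimP => m /=.
apply/eqP; rewrite -tofrac_eq tofrac_P_poly /P_frac /= /Peval /Pterm subn0.
rewrite (eq_bigr (fun=> 1)) => [|w _]; last by rewrite !big1 ?mulr1.
rewrite sumr_const card_Sn mulVf ?tofrac1 //.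
by rewrite -(prednK (fact_gt0 _)); apply: frac_char0; apply: Sq_char0.
Qed.

End FactorialQ.

Section GeneratedAlgebra.
Variables (R : comNzRingType) (A : algType R).

Inductive subalg (G : seq A) : A -> Prop :=
| subalg_gen g of g \in G : subalg G g
| subalg_const c : subalg G c%:A
| subalg_add x y of subalg G x & subalg G y : subalg G (x + y)
| subalg_mul x y of subalg G x & subalg G y : subalg G (x * y).

Definition gen_ideal (B : A -> Prop) (r : seq A) (x : A) : Prop :=
  exists2 b : nat -> A, (forall i, B (b i)) & x = \sum_(i < size r) b i * r`_i.

Definition congr_ideal (B : A -> Prop) (r : seq A) (x y : A) : Prop :=
  [/\ B x, B y & gen_ideal B r (x - y)].

End GeneratedAlgebra.

Definition strict_partition (la : seq nat) : bool :=
  sorted gtn la && (0%N \notin la).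

Definition SP (n : nat) (la : seq nat) : bool :=
  strict_partition la && (head 0%N la <= n)%N.

(* S[q][Q_1, ..., Q_n, 2 Q_{n+1}, Q_{n+2}, ..., Q_{2n}] *)
Definition Qring (n : nat) : plim (Sq n) -> Prop :=
  subalg ([seq Q_fun n [:: k] | k <- iota 1 n] ++
          2%:R *: Q_fun n [:: n.+1] ::
          [seq Q_fun n [:: k] | k <- iota n.+2 n.-1]).

Arguments Qring n x : clear implicits.

(* generators of J_n^(q) *)
Definition Jgens (n : nat) : seq (plim (Sq n)) :=
  (2%:R *: Q_fun n [:: n.+1] - (qvar n)%:A) ::
  [seq Q_fun n [:: k] | k <- iota n.+2 n.-1].

(* Main.v *)
From HB Require Import structures.
Require Import Defs.
From mathcomp Require Import all_boot all_order all_fingroup all_algebra.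
From mathcomp Require Import mpoly ring zify.

(**
In an even number of variables X, put W(x) = prod_{y <> x} (x + y)/(x - y). Then
P_la(X | u) is the sum, over all tuples (y_1, ..., y_l) of elements of X, of
prod_k (y_k | u)^{la_k} W(y_k) times prod_{i < j} (y_j - y_i)/(y_j + y_i); tuples
with repetitions contribute 0. Three identities come out of this form.

- Splitting sum_{x in X} x into the part inside and outside {y_1, ..., y_l}, and
  using sum x W(x) = sum x on the outside part, gives the equivariant Pieri rule
  for Q_1 Q_la, without restriction on the parts.
- Expanding the Schur Pfaffian in its first variable gives
  Q_(k,nu) - Q_k Q_nu = sum_j +-(Q_(k,nu_j) - Q_k Q_(nu_j)) Q_(nu without nu_j).
- Multiplying (y' - y)/(y' + y) by y + y' gives a recursion on l for
  Z_(k,l) = Q_(k,l) - Q_k Q_l, which is then a combination of 2 Q_k, ..., 2 Q_(k+l),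
  and of 2 Q_(k+1), ..., 2 Q_(k+l) only if t_k = 0.

Hence Q_la lies in the ring for la in SP(n), and 2 Q_(n+1,nu) is congruent to
2 Q_(n+1) Q_nu, hence to q Q_nu. The shape (n+1, la_2, ...) is the only one in the
Pieri rule that leaves SP(n), and it produces the quantum term.
*)

Set Implicit Arguments.
Unset Strict Implicit.
Unset Printing Implicit Defensive.

Import GRing.Theory.
Local Open Scope ring_scope.

(** * Deleting one entry of a list *)

Section DeleteNth.
Variable T : Type.
Implicit Type s : seq T.

Definition del s j := take j s ++ drop j.+1 s.

Lemma split_nth (x0 : T) s j : (j < size s)%N ->
  s = take j s ++ nth x0 s j :: drop j.+1 s.
Proof. by move=> lt_js; rewrite -drop_nth // cat_take_drop. Qed.

Lemma nth_del (x0 : T) s j i : nth x0 (del s j) i = nth x0 s (bump j i).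
Proof.
rewrite /del nth_cat size_take nth_drop /bump; case: (ltnP j (size s)) => lt_js.
  case: ltnP => lt_ij /=; first by rewrite nth_take // add0n.
  by rewrite addSn subnKC // add1n.
case: (ltnP i (size s)) => le_is.
  by rewrite nth_take ?(leq_trans le_is) // leqNgt (leq_trans le_is).
rewrite [LHS]nth_default; first by rewrite nth_default // (leq_trans le_is) ?leq_addl.
by rewrite (leq_trans lt_js) // addSn ltnW // ltnS leq_addr.
Qed.

Lemma size_del s j : (j < size s)%N -> size (del s j) = (size s).-1.
Proof.
move=> lt_js; rewrite size_cat size_take size_drop lt_js.
by case: (size s) lt_js => // m; rewrite ltnS subSS => /subnKC.
Qed.

End DeleteNth.

Lemma mem_del (T : eqType) (s : seq T) j : {subset del s j <= s}.
Proof. by move=> x; rewrite mem_cat => /orP[/mem_take|/mem_drop]. Qed.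

(** * Partial fractions and the Schur Pfaffian *)

Section PartialFractions.
Variable K : fieldType.
Implicit Types (s : seq K) (x y : K).

Definition weight s x : K := \prod_(y <- s | y != x) ((x + y) / (x - y)).

Lemma prod_oppr s (F : K -> K) :
  \prod_(x <- s) - F x = (-1) ^+ size s * \prod_(x <- s) F x.
Proof.
elim: s => [|x s IH]; first by rewrite !big_nil mulr1.
by rewrite !big_cons IH exprS; ring.
Qed.

Lemma size_prod_XsubC_neq s x : uniq s -> x \in s ->
  size (\prod_(y <- s | y != x) ('X - y%:P)) = size s.
Proof.
move=> us xs; rewrite -big_filter size_prod_XsubC -rem_filter // size_rem //.
by rewrite prednK //; case: s xs {us}.
Qed.

(** Lagrange interpolation at the nodes [s]: the leading terms on the left cancel, so both sides
    have degree below [size s], and they agree at every node. *)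
Lemma prod_XaddC_subC s : uniq s ->
  \prod_(x <- s) ('X + x%:P) - \prod_(x <- s) ('X - x%:P) =
  \sum_(x <- s) (2%:R * x * weight s x) *: \prod_(y <- s | y != x) ('X - y%:P).
Proof.
move=> us; apply/eqP; rewrite -subr_eq0; apply/eqP.
have prodXaddE : \prod_(x <- s) ('X + x%:P) = \prod_(x <- map -%R s) ('X - x%:P).
  by rewrite big_map; apply: eq_bigr => x _; rewrite polyCN opprK.
set D := _ - _; have sD : (size D <= size s)%N.
  apply: (leq_trans (size_polyD _ _)); rewrite geq_max size_polyN; apply/andP; split.
    apply/leq_sizeP => i; rewrite leq_eqVlt coefB prodXaddE => /predU1P[<-|lt_si].
      have := monicP (monic_prod_XsubC (map -%R s) xpredT id).
      have := monicP (monic_prod_XsubC s xpredT id).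
      rewrite !lead_coefE !size_prod_XsubC size_map /= => -> ->.
      by rewrite subrr.
    by rewrite !nth_default ?subr0 // size_prod_XsubC ?size_map.
  rewrite big_seq; elim/big_ind: _ => [|p q sp sq|x xs]; first by rewrite size_poly0.
    by apply: (leq_trans (size_polyD _ _)); rewrite geq_max sp.
  by apply: (leq_trans (size_scale_leq _ _)); rewrite size_prod_XsubC_neq.
apply/eqP; apply: contraTT sD => nD; rewrite -ltnNge.
apply: max_poly_roots => //; apply/allP => x xs.
rewrite /root /D !(hornerD, hornerN) !horner_prod horner_sum.
rewrite [X in _ - X - _](bigD1_seq x) //= hornerXsubC subrr mul0r subr0.
rewrite [X in _ - X](bigD1_seq x) //= [X in _ - (_ + X)]big1 => [|y nyx]; last first.
  rewrite hornerZ horner_prod -big_filter (bigD1_seq x) ?filter_uniq //=.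
    by rewrite hornerXsubC subrr mul0r mulr0.
  by rewrite mem_filter eq_sym nyx.
rewrite addr0 (bigD1_seq x) //= !hornerE horner_prod /weight subr_eq0; apply/eqP.
rewrite -[RHS]mulrA -big_split /=; congr (_ * _); first by ring.
by apply: eq_bigr => y nyx; rewrite !hornerE divfK // subr_eq0 eq_sym.
Qed.

(** Compare the coefficients of X^(|s|-1) in [prod_XaddC_subC] and cancel the common factor 2. *)
Lemma sum_weight s : 2%:R != 0 :> K -> uniq s ->
  \sum_(x <- s) x * weight s x = \sum_(x <- s) x.
Proof.
move=> n2 us; case: (posnP (size s)) => [/size0nil ->|s_gt0]; first by rewrite !big_nil.
have /(congr1 (fun p : {poly K} => p`_(size s).-1)) := prod_XaddC_subC us.
have -> : \prod_(x <- s) ('X + x%:P) = \prod_(x <- map -%R s) ('X - x%:P).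
  by rewrite big_map; apply: eq_bigr => x _; rewrite polyCN opprK.
rewrite coefB -{1}(size_map -%R s) !coefPn_prod_XsubC ?size_map -?lt0n //.
rewrite big_map sumrN !opprK coef_sum => E; apply: (mulfI n2).
rewrite [RHS]mulr_natl [RHS]mulr2n E mulr_sumr [LHS]big_seq [RHS]big_seq; apply: eq_bigr => x xs.
have := monicP (monic_prod_XsubC s (predC1 x) id).
by rewrite lead_coefE size_prod_XsubC_neq // coefZ mulrA => ->; rewrite mulr1.
Qed.

(** Evaluate [prod_XaddC_subC] at -y and divide by the product of the x + y. *)
Lemma prod_sk_sign s y : uniq s -> {in s, forall x, x + y != 0} ->
  \prod_(x <- s) ((x - y) / (x + y)) - (-1) ^+ size s =
  \sum_(x <- s) (\prod_(z <- s | z != x) ((z + x) / (z - x))) * (2%:R * x / (x + y)).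
Proof.
move=> us nz; have nA : \prod_(x <- s) (x + y) != 0.
  by rewrite prodf_seq_neq0; apply/allP => x /nz.
apply: (mulIf nA); rewrite mulrBl -big_split /= mulr_suml.
have /(congr1 (fun p : {poly K} => p.[- y])) := prod_XaddC_subC us.
rewrite !(hornerD, hornerN) !horner_prod horner_sum => E.
transitivity (\prod_(x <- s) ('X + x%:P).[- y] - \prod_(x <- s) ('X - x%:P).[- y]).
  congr (_ - _).
    rewrite [LHS]big_seq [RHS]big_seq; apply: eq_bigr => x /nz nx.
    by rewrite divfK // !hornerE addrC.
  by rewrite -prod_oppr; apply: eq_bigr => x _; rewrite !hornerE opprD addrC.
rewrite {}E [LHS]big_seq [RHS]big_seq; apply: eq_bigr => x xs.
rewrite !hornerE horner_prod [in RHS](bigD1_seq x) //= -!mulrA.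
have -> : (x + y)^-1 * ((x + y) * \prod_(z <- s | z != x) (z + y)) =
    \prod_(z <- s | z != x) (z + y) by rewrite mulKf // nz.
rewrite [RHS]mulrC -!mulrA; congr (_ * (_ * _)).
rewrite -!big_split /=; apply: eq_bigr => z nzx.
by rewrite !hornerE /= -[x - z]opprB invrN; ring.
Qed.

(** Subtracting the case y = 0 of [prod_sk_sign] removes the sign (-1)^|s|, so that no distinction
    of parity remains. *)
Lemma prod_sk s y : uniq s -> {in s, forall x, x + y != 0} -> 0 \notin s ->
  \prod_(x <- s) ((x - y) / (x + y)) - 1 =
  \sum_(x <- s) (\prod_(z <- s | z != x) ((z + x) / (z - x))) * ((x - y) / (x + y) - 1).
Proof.
move=> us nz s0; have nz0 : {in s, forall x, x + 0 != 0}.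
  by move=> x xs; rewrite addr0; apply: contraNneq s0 => <-.
have E := prod_sk_sign us nz; have E0 := prod_sk_sign us nz0.
rewrite big1_seq in E0 => [|x /= /nz0]; last by rewrite subr0 addr0 => nx; rewrite divff.
rewrite -[X in X - 1](subrK ((-1) ^+ size s)) -addrA -[_ - 1]opprB E E0.
rewrite -sumrB [LHS]big_seq [RHS]big_seq; apply: eq_bigr => x xs.
have := nz0 x xs; rewrite -mulrBr addr0 => nx; congr (_ * _).
by field; rewrite nz // nx.
Qed.

Definition sk x y := (y - x) / (y + x).

Fixpoint delta s : K :=
  if s is x :: s' then (\prod_(y <- s') sk x y) * delta s' else 1.

Lemma skN x y : sk x y = - sk y x.
Proof. by rewrite /sk -[y - x]opprB mulNr (addrC x y). Qed.

Lemma skxx x : sk x x = 0.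
Proof. by rewrite /sk subrr mul0r. Qed.

Lemma delta_mid s1 x s2 :
  delta (s1 ++ x :: s2) =
  (\prod_(y <- s1) sk y x) * (\prod_(y <- s2) sk x y) * delta (s1 ++ s2).
Proof.
elim: s1 => [|z s1 IH] /=; first by rewrite big_nil mul1r.
by rewrite IH !big_cat !big_cons /=; ring.
Qed.

Lemma delta_rcons s x : delta (rcons s x) = delta s * \prod_(y <- s) sk y x.
Proof. by rewrite -cats1 delta_mid big_nil mulr1 cats0 mulrC. Qed.

Lemma delta_swap s1 x y s2 :
  delta (s1 ++ x :: y :: s2) = - delta (s1 ++ y :: x :: s2).
Proof.
by rewrite !delta_mid !big_cons [sk x y]skN; ring.
Qed.

Lemma delta_nuniq s : ~~ uniq s -> delta s = 0.
Proof.
elim: s => //= x s IH; rewrite negb_and negbK => /orP[xs|/IH ->]; last by rewrite mulr0.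
by rewrite (big_rem x) //= skxx !mul0r.
Qed.

(** The ratios cancel the factors of [delta s] that involve x, up to a factor -1 for each entry of
    [s1], since these stand before x. *)
Lemma delta_mid_uniq s1 x s2 (s := s1 ++ x :: s2) :
    uniq s -> {in s &, forall y z, y + z != 0} ->
  (-1) ^+ size s1 * delta (s1 ++ s2) =
  delta s * \prod_(z <- s | z != x) ((z + x) / (z - x)).
Proof.
rewrite /s => us nz.
move: (us); rewrite cat_uniq /= => /and3P[u1 /norP[nx _] /andP[nx2 u2]].
rewrite delta_mid big_cat big_cons eqxx /=.
have s1x z : z \in s1 -> z != x by move=> zs; apply: contraNneq nx => <-.
have s2x z : z \in s2 -> z != x by move=> zs; apply: contraNneq nx2 => <-.
have xin : x \in s1 ++ x :: s2 by rewrite mem_cat inE eqxx orbT.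
have E1 : \prod_(y <- s1) sk y x * \prod_(z <- s1 | z != x) ((z + x) / (z - x)) = (-1) ^+ size s1.
  rewrite [X in _ * X]big_seq_cond (eq_bigl (mem s1)); last first.
    by move=> z /=; case: (boolP (z \in s1)) => // /s1x ->.
  rewrite -big_seq -big_split /= big_seq (eq_bigr (fun=> - 1)) => [|z zs].
    by rewrite -big_seq prod_oppr big1 ?mulr1.
  have zx := s1x _ zs; have nzx : z + x != 0 by apply: nz; rewrite // mem_cat zs.
  by rewrite /sk; field; rewrite subr_eq0 zx addrC nzx.
have E2 : \prod_(y <- s2) sk x y * \prod_(z <- s2 | z != x) ((z + x) / (z - x)) = 1.
  rewrite [X in _ * X]big_seq_cond (eq_bigl (mem s2)); last first.
    by move=> z /=; case: (boolP (z \in s2)) => // /s2x ->.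
  rewrite -big_seq -big_split /= big_seq big1 // => z zs.
  have zx := s2x _ zs; have nzx : z + x != 0.
    by apply: nz; rewrite // mem_cat inE zs !orbT.
  by rewrite /sk; field; rewrite nzx subr_eq0 zx.
by rewrite -E1 -[LHS]mulr1 -[X in _ * X = _]E2; ring.
Qed.

Lemma delta_del s j : uniq s -> {in s &, forall x y, x + y != 0} -> (j < size s)%N ->
  (-1) ^+ j * delta (del s j) =
  delta s * \prod_(z <- s | z != nth 0 s j) ((z + nth 0 s j) / (z - nth 0 s j)).
Proof.
move=> us nz lt_js.
have := @delta_mid_uniq (take j s) (nth 0 s j) (drop j.+1 s).
by rewrite -split_nth // size_takel ?(ltnW lt_js) //; apply.
Qed.

(** With equal entries at positions i < j, deleting any other position leaves a repetition, so only
    the terms i and j survive. They are opposite: moving the common value across the j - i - 1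
    entries in between gives the sign that is needed. *)
Lemma sum_delta_del_nuniq s (g : K -> K) : ~~ uniq s ->
  \sum_(j < size s) (-1) ^+ j * g (nth 0 s j) * delta (del s j) = 0.
Proof.
case/(uniqPn 0) => i [j [lt_ij lt_js Eij]]; have lt_is := ltn_trans lt_ij lt_js.
rewrite (bigD1 (Ordinal lt_is)) // (bigD1 (Ordinal lt_js)) /=; last first.
  by rewrite -val_eqE /= neq_ltn lt_ij orbT.
rewrite big1 ?addr0 => [|m /andP[]]; last first.
  rewrite -!val_eqE /= => nmi nmj; rewrite delta_nuniq ?mulr0 //.
  (* After position m is deleted, the equal entries stand at [unbump m i] and [unbump m j]. *)
  apply/(uniqPn 0); exists (unbump m i), (unbump m j).
  have bi : bump m (unbump m i) = i by rewrite unbumpK // inE eq_sym.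
  have bj : bump m (unbump m j) = j by rewrite unbumpK // inE eq_sym.
  have lt_b : (unbump m i < unbump m j)%N.
    by rewrite ltnNge -(leq_bump2 m) bi bj -ltnNge.
  split=> //; last by rewrite !nth_del bi bj.
  have lt_s : (unbump m j < size s)%N by rewrite (leq_ltn_trans _ lt_js) // leq_subr.
  rewrite size_del // -ltnS (prednK (leq_ltn_trans (leq0n _) lt_s)).
  move: nmj lt_js; rewrite neq_ltn /unbump => /orP[lt_mj|lt_jm] lt_js.
    by rewrite lt_mj subn1 (prednK (leq_ltn_trans (leq0n _) lt_mj)).
  by rewrite (ltnNge m j) (ltnW lt_jm) subn0 (leq_ltn_trans lt_jm).
have [s1 [s2 [s3 [sE z1 z2]]]] : exists s1 s2 s3, [/\ s = s1 ++ nth 0 s i :: s2 ++ nth 0 s i :: s3,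
     size s1 = i & size s2 = (j - i.+1)%N].
  have lt2 : (j - i.+1 < size (drop i.+1 s))%N 
    by rewrite size_drop; apply: ltn_sub2r => //; apply: leq_ltn_trans lt_js.
  exists (take i s), (take (j - i.+1) (drop i.+1 s)), (drop (j - i.+1).+1 (drop i.+1 s)).
  rewrite size_takel ?(ltnW lt_is) // size_takel ?(ltnW lt2) //; split=> //.
  rewrite {1}(split_nth 0 lt_is) {1}(split_nth 0 lt2) nth_drop subnKC //.
  by rewrite Eij.
set c := nth 0 s i in Eij sE *.
have jE : j = (size s1 + (size s2).+1)%N by rewrite z1 z2 addnS -addSn subnKC.
rewrite -Eij.
have dI : delta (del s i) = delta (s1 ++ s2 ++ c :: s3).
  by rewrite /del {1 2}sE -z1 take_size_cat // -cat_rcons drop_size_cat // size_rcons.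
have dJ : delta (del s j) = delta (s1 ++ c :: s2 ++ s3).
  rewrite -[s1 ++ _]/(s1 ++ (c :: s2) ++ s3) catA.
  have -> : s = (s1 ++ c :: s2) ++ c :: s3 by rewrite sE -catA.
  rewrite /del jE take_size_cat ?size_cat //; congr (delta (_ ++ _)).
  by rewrite -cat_rcons drop_size_cat ?size_rcons ?size_cat.
rewrite dI dJ catA !delta_mid !big_cat /= -catA.
have -> : \prod_(y <- s2) sk y c = (-1) ^+ size s2 * \prod_(y <- s2) sk c y.
  by rewrite -prod_oppr; apply: eq_bigr => y _; rewrite skN.
by rewrite jE z1 exprD exprS; ring.
Qed.

(* Expansion of the Schur Pfaffian prod_{i<j} (x_j - x_i)/(x_j + x_i) along its
   first variable, written so that the same formula holds for both parities. *)
Lemma delta_expand x s : {in x :: s &, forall y z, y + z != 0} ->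
  delta (x :: s) - delta s =
  \sum_(j < size s) (-1) ^+ j * (sk x (nth 0 s j) - 1) * delta (del s j).
Proof.
move=> nz; case: (boolP (uniq s)) => [us|nu]; last first.
  by rewrite (sum_delta_del_nuniq (fun y => sk x y - 1)) //= delta_nuniq // mulr0 subrr.
(* The hypothesis for y = z = 0 excludes 0, as [prod_sk] requires. *)
have s0 : 0 \notin s.
  apply/negP => s0; have := nz 0 0; rewrite !inE s0 !orbT addr0 eqxx => H.
  by move: (H isT isT).
have nzs : {in s &, forall y z, y + z != 0}.
  by move=> y z ys zs; apply: nz; rewrite inE ?ys ?zs orbT.
have nzx : {in s, forall y, y + x != 0}.
  by move=> y ys; apply: nz; rewrite inE ?ys ?eqxx ?orbT.
rewrite /= -[X in _ - X]mul1r -mulrBl /sk prod_sk // (big_nth 0) big_mkord mulr_suml.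
by apply: eq_bigr => j _; rewrite [RHS]mulrAC delta_del //; ring.
Qed.

End PartialFractions.

(** * P-functions as iterated sums *)

Section MultiSum.
Variables (K : fieldType) (u : nat -> K) (X : seq K).
Implicit Types (la : seq nat) (F : seq K -> K).

Definition wffact k x : K := ffact u x k * weight X x.

Lemma wffactS k x : wffact k.+1 x = (x - u k.+1) * wffact k x.
Proof. by rewrite /wffact /ffact big_nat_recr //= -mulrA mulrCA. Qed.

(** F receives the whole tuple of chosen points. Repetitions are allowed, so the sums are
    independent and can be exchanged or split off one by one. *)
Fixpoint msum la F : K :=
  if la is k :: la' then \sum_(x <- X) wffact k x * msum la' (fun Y => F (x :: Y))
  else F [::].

Lemma eq_msum la F F' :
    (forall Y, size Y = size la -> {subset Y <= X} -> F Y = F' Y) ->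
  msum la F = msum la F'.
Proof.
elim: la F F' => [|k la IH] F F' E /=; first exact: E.
rewrite big_seq [RHS]big_seq; apply: eq_bigr => x xX; congr (_ * _).
apply: IH => Y sY YX; apply: E => /=; first by rewrite sY.
by move=> y; rewrite inE => /predU1P[->|/YX].
Qed.

Lemma msumZ la c F : msum la (fun Y => c * F Y) = c * msum la F.
Proof.
elim: la F => [|k la IH] F //=; rewrite mulr_sumr; apply: eq_bigr => x _.
by rewrite IH mulrCA.
Qed.

Lemma msumD la F F' : msum la (fun Y => F Y + F' Y) = msum la F + msum la F'.
Proof.
elim: la F F' => [|k la IH] F F' //=; rewrite -big_split; apply: eq_bigr => x _ /=.
by rewrite IH mulrDr.
Qed.

Lemma msum_sum la (I : Type) (r : seq I) (F : I -> seq K -> K) :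
  msum la (fun Y => \sum_(i <- r) F i Y) = \sum_(i <- r) msum la (F i).
Proof.
elim: la F => [|k la IH] F //=; rewrite exchange_big; apply: eq_bigr => x _ /=.
by rewrite IH mulr_sumr.
Qed.

(** The summand separates into a function of the j-th point and a function of the others. *)
Lemma msum_del la j (g : K -> K) F : (j < size la)%N ->
  msum la (fun Y => g (nth 0 Y j) * F (del Y j)) =
  (\sum_(x <- X) wffact (nth 0%N la j) x * g x) * msum (del la j) F.
Proof.
elim: la j F => [|k la IH] [|j] F //=.
  move=> _; rewrite mulr_suml; apply: eq_bigr => x _; rewrite msumZ mulrA.
  by congr (_ * _); rewrite /del /= drop0; apply: eq_msum => Y _ _; rewrite /del /= drop0.
rewrite ltnS => lt_j; rewrite mulr_sumr; apply: eq_bigr => x _.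
by rewrite (IH j (fun Y => F (x :: Y))) // mulrCA.
Qed.

Lemma msum_rcons la k F :
  msum (rcons la k) F = msum la (fun Y => \sum_(x <- X) wffact k x * F (rcons Y x)).
Proof. by elim: la F => [|l la IH] F //=; apply: eq_bigr => x _; rewrite IH. Qed.

(** Exchange the two adjacent sums: swapping the rows k and l amounts to swapping two arguments of
    F. *)
Lemma msum_anti la k l mu F :
    (forall Y x y Z, size Y = size la -> F (Y ++ x :: y :: Z) = - F (Y ++ y :: x :: Z)) ->
  msum (la ++ k :: l :: mu) F = - msum (la ++ l :: k :: mu) F.
Proof.
elim: la F => [|j la IH] F FN /=; last first.
  rewrite -sumrN; apply: eq_bigr => x _; rewrite IH ?mulrN // => Y y z Z sY.
  by rewrite -[x :: _]/((x :: Y) ++ y :: z :: Z) FN //= sY.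
under eq_bigr do rewrite mulr_sumr; under [in RHS]eq_bigr do rewrite mulr_sumr.
rewrite exchange_big -sumrN; apply: eq_bigr => x _; rewrite -sumrN; apply: eq_bigr => y _ /=.
rewrite (@eq_msum mu _ (fun Z => -1 * F [:: x, y & Z])) ?msumZ => [|Z _ _].
  by rewrite mulN1r !mulrN mulrCA.
by rewrite mulN1r (FN [::]).
Qed.

(** Write y_i as (y_i - u_(k+1)) + u_(k+1), with k the row at i; the first part lengthens the
    factorial power by one. *)
Lemma msum_incr la i F : (i < size la)%N ->
  msum la (fun Y => nth 0 Y i * F Y) =
  msum (incr_nth la i) F + u (nth 0%N la i).+1 * msum la F.
Proof.
elim: la i F => [|k la IH] [|i] F //=.
  move=> _; rewrite mulr_sumr -big_split; apply: eq_bigr => x _ /=; rewrite msumZ.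
  by rewrite wffactS; ring.
rewrite ltnS => lt_i; rewrite mulr_sumr -big_split; apply: eq_bigr => x _ /=.
by rewrite IH //; ring.
Qed.

Definition Psum la := msum la (@delta K).

Lemma Psum_adj la k mu : 2%:R != 0 :> K -> Psum (la ++ k :: k :: mu) = 0.
Proof.
move=> n2; apply/eqP; rewrite -(mulrI_eq0 _ (mulfI n2)) mulr_natl mulr2n.
rewrite {1}/Psum msum_anti ?addNr // => Y x y Z _; exact: delta_swap.
Qed.

Hypotheses (uX : uniq X) (nzX : {in X &, forall x y, x + y != 0}).
Hypothesis n2 : 2%:R != 0 :> K.

(** For x in Y the product contains [sk x x], which is 0. For x outside Y it cancels the factors of
    the weight coming from Y; what is left is the weight of x in X without Y, where [sum_weight]
    applies. *)
Lemma sum_split_weight Y : uniq Y -> {subset Y <= X} ->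
  \sum_(x <- X) x =
  \sum_(x <- Y) x + \sum_(x <- X) x * weight X x * \prod_(y <- Y) sk y x.
Proof.
move=> uY YX; rewrite (bigID (mem Y)) /= -big_filter.
rewrite (perm_big Y) /=; last first.
  apply: uniq_perm; rewrite ?filter_uniq // => x; rewrite mem_filter /=.
  by case: (boolP (x \in Y)) => // /YX ->.
congr (_ + _); rewrite [RHS](bigID (mem Y)) /= [X in _ = X + _]big1 ?add0r; last first.
  by move=> x xY; rewrite [X in _ * X](big_rem x) //= skxx mul0r mulr0.
rewrite -big_filter -sum_weight ?filter_uniq // big_filter.
rewrite big_seq_cond [RHS]big_seq_cond; apply: eq_bigr => x /andP[xX xY].
rewrite -mulrA; congr (_ * _).
rewrite /weight [X in _ = X * _](bigID (mem Y)) /= [RHS]mulrC mulrA.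
rewrite big_filter_cond; set B := \prod_(i <- X | _) _; set C := \prod_(i <- X | _) _.
suff -> : \prod_(y <- Y) sk y x * C = 1.
  by rewrite mul1r /B; apply: eq_bigl => y; rewrite andbC.
rewrite /C -[X in _ * X]big_filter [X in _ * X](perm_big Y) /=; last first.
  apply: uniq_perm; rewrite ?filter_uniq // => y; rewrite mem_filter /=.
  case: (boolP (y \in Y)) => [yY|]; last by rewrite andbF.
  by rewrite YX // !andbT; apply: contraNneq xY => <-.
rewrite -big_split big_seq big1 //= => y yY; have nxy := nzX xX (YX y yY).
have dxy : x - y != 0 by rewrite subr_eq0; apply: contraNneq xY => ->.
by rewrite /sk; field; rewrite nxy dxy.
Qed.

(** Since u_1 = 0, the first factor is the sum of all points. It is split by [sum_split_weight] for
    each tuple Y: the points outside Y form a new last row 1, those in Y raise the existing rows. *)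
Lemma Psum_Pieri la : u 1%N = 0 ->
  Psum [:: 1%N] * Psum la =
  Psum (rcons la 1%N) +
  \sum_(i < size la) (Psum (incr_nth la i) + u (nth 0%N la i).+1 * Psum la).
Proof.
move=> u1; have f1 x : ffact u x 1 = x by rewrite /ffact big_nat1 u1 subr0.
have -> : Psum [:: 1%N] = \sum_(x <- X) x.
  rewrite (@sum_split_weight [::]) // big_nil add0r; apply: eq_bigr => x _.
  by rewrite /= /wffact f1 !big_nil !mulr1.
rewrite /Psum -msumZ msum_rcons.
transitivity (msum la (fun Y => \sum_(x <- X) wffact 1 x * delta (rcons Y x) +
   \sum_(i < size la) nth 0 Y i * delta Y)); last first.
  rewrite msumD; congr (_ + _); rewrite msum_sum; apply: eq_bigr => i _.
  exact: msum_incr.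
(* On a tuple with a repetition every term contains a vanishing [delta]. *)
apply: eq_msum => Y sY YX; case: (boolP (uniq Y)) => [uY|/delta_nuniq d0]; last first.
  rewrite d0 mulr0 !big1 ?addr0 // => [i _|x _]; first by rewrite mulr0.
  by rewrite delta_rcons d0 mul0r mulr0.
rewrite (sum_split_weight uY YX) mulrDl addrC mulr_suml; congr (_ + _).
  by apply: eq_bigr => x _; rewrite delta_rcons /wffact f1; ring.
by rewrite (big_nth 0) big_mkord mulr_suml sY.
Qed.

(** Apply [delta_expand] with the point of row k as first variable; in each term the points of the
    rows k and nu_j then separate from the remaining ones. *)
Lemma Psum_expand k nu :
  Psum (k :: nu) - Psum [:: k] * Psum nu =
  \sum_(j < size nu) (-1) ^+ j *
     (Psum [:: k; nth 0%N nu j] - Psum [:: k] * Psum [:: nth 0%N nu j]) *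
     Psum (del nu j).
Proof.
have P1 l : Psum [:: l] = \sum_(x <- X) wffact l x.
  by rewrite /Psum /=; apply: eq_bigr => x _; rewrite big_nil !mulr1.
rewrite {1}/Psum /= P1 mulr_suml -sumrB.
transitivity (\sum_(x <- X) \sum_(j < size nu) wffact k x *
   ((-1) ^+ j * ((\sum_(y <- X) wffact (nth 0%N nu j) y * (sk x y - 1)) * Psum (del nu j)))).
  rewrite big_seq [RHS]big_seq; apply: eq_bigr => x xX; rewrite -mulrBr -mulr_sumr; congr (_ * _).
  have -> : - Psum nu = msum nu (fun Y => -1 * delta Y) by rewrite msumZ mulN1r.
  rewrite -msumD (@eq_msum nu _ (fun Y => \sum_(j < size nu)
     (-1) ^+ j * ((sk x (nth 0 Y j) - 1) * delta (del Y j)))) => [|Y sY YX].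
    by rewrite msum_sum; apply: eq_bigr => j _; rewrite msumZ (msum_del (fun y => sk x y - 1)).
  rewrite mulN1r -[X in X - _]/(delta (x :: Y)) delta_expand ?sY.
    by apply: eq_bigr => j _; rewrite mulrA.
  have sX : {subset x :: Y <= X} by move=> y; rewrite inE => /predU1P[->|/YX].
  by move=> y z /sX yX /sX zX; apply: nzX.
rewrite exchange_big; apply: eq_bigr => j _ /=.
rewrite -(P1 k); set l := nth _ _ _.
have -> : Psum [:: k; l] - Psum [:: k] * Psum [:: l] =
    \sum_(x <- X) wffact k x * (\sum_(y <- X) wffact l y * (sk x y - 1)).
  rewrite !P1 {1}/Psum /= mulr_suml -sumrB; apply: eq_bigr => x _.
  rewrite -mulrBr -sumrB; congr (_ * _); apply: eq_bigr => y _.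
  by rewrite big_seq1 big_nil !mulr1 mulrBr mulr1.
by rewrite mulr_sumr mulr_suml; apply: eq_bigr => x _; ring.
Qed.

(** This is the identity (x + y) [sk x y] = y - x under the double sum, with x and y expanded as (x
    - u_(k+1)) + u_(k+1) and (y - u_(l+1)) + u_(l+1). *)
Lemma Psum_two_rows k l :
  Psum [:: k; l.+1] + Psum [:: k.+1; l] + (u k.+1 + u l.+1) * Psum [:: k; l] =
  Psum [:: k] * Psum [:: l.+1] - Psum [:: k.+1] * Psum [:: l]
  + (u l.+1 - u k.+1) * (Psum [:: k] * Psum [:: l]).
Proof.
have P2 i j : Psum [:: i; j] = \sum_(x <- X) \sum_(y <- X) wffact i x * wffact j y * sk x y.
  rewrite /Psum /=; apply: eq_bigr => x _; rewrite mulr_sumr; apply: eq_bigr => y _.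
  by rewrite big_seq1 big_nil !mulr1 mulrA.
have P11 i j : Psum [:: i] * Psum [:: j] = \sum_(x <- X) \sum_(y <- X) wffact i x * wffact j y.
  rewrite /Psum /= big_distrlr; apply: eq_bigr => x _; apply: eq_bigr => y _.
  by rewrite !big_nil !mulr1.
rewrite !P2 !P11 mulr_sumr [in RHS]mulr_sumr -sumrB -!big_split /=.
rewrite big_seq [RHS]big_seq; apply: eq_bigr => x xX.
rewrite !mulr_sumr -sumrB -!big_split /=.
rewrite big_seq [RHS]big_seq; apply: eq_bigr => y yX.
by rewrite !wffactS /sk; field; rewrite nzX.
Qed.

End MultiSum.

(** * Comparison with the symmetrization formula *)

Section PevalPsum.
Variables (K : fieldType) (u : nat -> K).

Lemma big_ffun_recl (T : finType) (l : nat) (G : {ffun 'I_l.+1 -> T} -> K) :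
  \sum_f G f = \sum_i \sum_(f : {ffun 'I_l -> T})
     G [ffun k => if unlift ord0 k is Some k' then f k' else i].
Proof.
rewrite pair_big /=.
rewrite (reindex (fun p : T * {ffun 'I_l -> T} =>
   [ffun k => if unlift ord0 k is Some k' then p.2 k' else p.1])) //=.
exists (fun f : {ffun 'I_l.+1 -> T} => (f ord0, [ffun k => f (lift ord0 k)])) => [[i f] _|f _].
  rewrite !ffunE unlift_none /=; congr (_, _); apply/ffunP => k.
  by rewrite !ffunE liftK.
by apply/ffunP => k; rewrite ffunE; case: unliftP => [k' ->|->]; rewrite /= ?ffunE.
Qed.

Lemma msum_ffun (N : nat) (a : 'I_N -> K) (la : seq nat) (F : seq K -> K) :
  msum u (codom a) la F =
  \sum_(f : {ffun 'I_(size la) -> 'I_N})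
    (\prod_(k < size la) wffact u (codom a) (nth 0%N la k) (a (f k))) *
    F [seq a (f k) | k <- enum 'I_(size la)].
Proof.
elim: la F => [|k la IH] F /=.
  rewrite (big_pred1
    [ffun k : 'I_0 => match k with Ordinal _ lt => False_rect _ (notF lt) end]) => [|f].
    by rewrite big_ord0 mul1r; case: (enum 'I_0) (size_enum_ord 0).
  by apply/esym/eqP/ffunP => -[].
rewrite big_ffun_recl big_image /=; apply: eq_bigr => i _; rewrite IH mulr_sumr.
apply: eq_bigr => f _; rewrite big_ord_recl ffunE unlift_none /= -mulrA.
congr (_ * (_ * F _)).
  by apply: eq_bigr => j _; rewrite ffunE liftK.
rewrite enum_ordSl /= ffunE unlift_none -map_comp; congr (_ :: _).
by apply: eq_map => j /=; rewrite ffunE liftK.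
Qed.

Lemma delta_enum (l : nat) (b : 'I_l -> K) :
  delta [seq b k | k <- enum 'I_l] =
  \prod_(k < l) \prod_(m < l | (k < m)%N) sk (b k) (b m).
Proof.
elim: l b => [|l IH] b; first by rewrite big_ord0; case: (enum 'I_0) (size_enum_ord 0).
rewrite enum_ordSl /= -map_comp (IH (b \o lift ord0)) big_ord_recl; congr (_ * _).
  by rewrite big_map big_enum [RHS]big_mkcond big_ord_recl /= mul1r.
apply: eq_bigr => k _; rewrite [RHS]big_mkcond big_ord_recl /= mul1r -big_mkcond /=.
by apply: eq_bigl.
Qed.

Variables (N : nat) (a : 'I_N -> K).
Hypotheses (inj_a : injective a) (nz_a : forall i j, a i + a j != 0).

Lemma weight_codom i : weight (codom a) (a i) = \prod_(j | j != i) Pratio a i j.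
Proof. by rewrite /weight big_image_cond; apply: eq_bigl => j; rewrite inj_eq. Qed.

(** For positions k < m the two weights contribute the ratio in both orders, while [Pinj] contains
    only one; the other is the inverse of [sk]. *)
Lemma Pinj_wffact (la : seq nat) (f : {ffun 'I_(size la) -> 'I_N}) : injective f ->
  Pinj u a f = (\prod_(k < size la) wffact u (codom a) (nth 0%N la k) (a (f k))) *
    delta [seq a (f k) | k <- enum 'I_(size la)].
Proof.
move=> inj_f; rewrite /Pinj delta_enum /wffact [X in _ = X * _]big_split /= -mulrA; congr (_ * _).
have WE k : weight (codom a) (a (f k)) =
    (\prod_(m | m != k) Pratio a (f k) (f m)) * \prod_(j | j \notin codom f) Pratio a (f k) j.
  rewrite weight_codom (bigID (mem (codom f))) /=; congr (_ * _); last first.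
    apply: eq_bigl => j; case: (boolP (j \in codom f)); rewrite ?andbF ?andbT //.
    by move=> nj; apply: contraNneq nj => ->; apply: codom_f.
  rewrite (eq_bigl (fun j => (j \in codom f) && (j != f k))) => [|j]; last exact: andbC.
  rewrite -big_enum_cond (perm_big (codom f)) /=.
    by rewrite big_image_cond; apply: eq_bigl => m; rewrite inj_eq.
  by apply: uniq_perm => [||j]; [exact: enum_uniq | exact/injectiveP | rewrite mem_enum].
under [X in _ = X * _]eq_bigr do rewrite WE.
rewrite !big_split /= [RHS]mulrAC; congr (_ * _).
have -> : \prod_(k < size la) \prod_(m < size la | m != k) Pratio a (f k) (f m) =
  (\prod_(k < size la) \prod_(m < size la | (k < m)%N) Pratio a (f k) (f m)) *
  \prod_(k < size la) \prod_(m < size la | (m < k)%N) Pratio a (f k) (f m).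
  rewrite -big_split; apply: eq_bigr => k _ /=.
  rewrite (bigID (fun m : 'I_(size la) => (k < m)%N)) /=; congr (_ * _); apply: eq_bigl => m.
    by rewrite -val_eqE /=; case: ltngtP.
  by rewrite -val_eqE /=; case: ltngtP.
rewrite -mulrA -[LHS]mulr1; congr (_ * _); apply/esym.
rewrite (exchange_big_dep xpredT) //= -big_split big1 //= => k _.
rewrite -big_split big1 //= => m lt_km; rewrite /Pratio /sk.
field; rewrite nz_a subr_eq0 (inj_eq inj_a) (inj_eq inj_f).
by move: lt_km; rewrite neq_ltn => ->; rewrite orbT.
Qed.

(** Non-injective tuples vanish by [delta_nuniq], so the sum over injections extends to all
    tuples. *)
Lemma Psum_Pinj (la : seq nat) :
  \sum_(f : {ffun 'I_(size la) -> 'I_N} | injectiveb f) Pinj u a f =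
  Psum u (codom a) la.
Proof.
rewrite /Psum msum_ffun [RHS](bigID (fun f : {ffun _ -> _} => injectiveb f)) /=.
rewrite [X in _ = _ + X]big1 ?addr0 => [|f nf]; last first.
  rewrite delta_nuniq ?mulr0 // (map_comp a f) map_inj_uniq //.
by apply: eq_bigr => f /injectiveP/Pinj_wffact ->.
Qed.

(** There is no injection, in agreement with the value 0 of [P_frac] when there are too few
    variables. *)
Lemma Psum_size_gt (la : seq nat) : (N < size la)%N -> Psum u (codom a) la = 0.
Proof.
move=> lt_N; rewrite -Psum_Pinj big1 // => f /injectiveP /leq_card.
by rewrite !card_ord leqNgt lt_N.
Qed.

End PevalPsum.

(** * Components of the projective limit in fraction fields *)

Section Levels.
Variable R : idomainType.
Hypothesis R0 : forall k, k.+1%:R != 0 :> R.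

Definition points (N : nat) : seq {fraction {mpoly R[N]}} :=
  codom (fun i : 'I_N => tofrac ('X_i : {mpoly R[N]})).

Lemma tofracX_inj N : injective (fun i : 'I_N => tofrac ('X_i : {mpoly R[N]})).
Proof. by move=> i j /eqP; rewrite tofrac_eq => /eqP /mpolyXU_inj. Qed.

Lemma tofracX_add_neq0 N (i j : 'I_N) :
  tofrac ('X_i : {mpoly R[N]}) + tofrac 'X_j != 0.
Proof.
rewrite -tofracD tofrac_eq0; apply/eqP => /(congr1 (fun p : {mpoly R[N]} => p@_U_(i))).
rewrite mcoeffD mcoeff0 !mcoeffXU eqxx; case: (j == i) => /eqP; last by rewrite addr0 oner_eq0.
by rewrite -natrD (negbTE (R0 _)).
Qed.

Lemma points_uniq N : uniq (points N).
Proof. by apply/injectiveP; apply: tofracX_inj. Qed.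

Lemma points_add_neq0 N : {in points N &, forall x y, x + y != 0}.
Proof. by move=> _ _ /codomP[i ->] /codomP[j ->]; apply: tofracX_add_neq0. Qed.

Lemma P_frac_Psum (u : nat -> R) la N :
  P_frac u la N = Psum (fun k => tofrac (u k)%:MP) (points N) la.
Proof.
rewrite /P_frac; case: leqP => [le_N|lt_N]; last first.
  by rewrite Psum_size_gt //; [apply: tofracX_inj | apply: tofracX_add_neq0].
rewrite PevalE // ?Psum_Pinj //; first exact: tofracX_inj.
  exact: tofracX_add_neq0.
by rewrite -(prednK (fact_gt0 _)); apply: frac_char0.
Qed.

(** These maps are ring morphisms and jointly injective, so an identity in the limit can be checked
    on the iterated sums at every level. *)
Definition level (m : nat) (f : plim R) : {fraction {mpoly R[m.*2]}} := tofrac (f m).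

Fact level_is_zmod_morphism m : zmod_morphism (level m).
Proof. by move=> f g; rewrite /level /= tofracB. Qed.
HB.instance Definition _ m := GRing.isZmodMorphism.Build (plim R)
  {fraction {mpoly R[m.*2]}} (level m) (level_is_zmod_morphism m).

Fact level_is_monoid_morphism m : monoid_morphism (level m).
Proof. by split=> [|f g]; rewrite /level /= ?tofrac1 ?tofracM. Qed.
HB.instance Definition _ m := GRing.isMonoidMorphism.Build (plim R)
  {fraction {mpoly R[m.*2]}} (level m) (level_is_monoid_morphism m).

Lemma level_inj f g : (forall m, level m f = level m g) -> f = g.
Proof. by move=> E; apply: plimP => m; apply/eqP; rewrite -tofrac_eq; apply/eqP/E. Qed.

Lemma levelZ m c f : level m (c *: f) = tofrac c%:MP * level m f.
Proof. by rewrite /level /= -mul_mpolyC tofracM. Qed.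

End Levels.

(** * Identities between factorial Q-functions *)

Section QIdentities.
Variables (R : idomainType) (R0 : forall k, k.+1%:R != 0 :> R) (u : nat -> R).

(** The parameters u are arbitrary here; [Q_fun] is the case u = (0, t_1, t_2, ...). *)
Definition Qgen la : plim R := 2%:R ^+ size la *: P_fun R0 u la.
Local Notation Q := Qgen.
Local Notation P m := (Psum (fun k => tofrac (u k)%:MP) (points R m.*2)).

Lemma levelQ m la : level m (Q la) = 2%:R ^+ size la * P m la.
Proof.
rewrite levelZ /level /= tofrac_P_poly P_frac_Psum //.
by rewrite !rmorphXn !rmorph_nat.
Qed.

Let frac2_neq0 m : 2%:R != 0 :> {fraction {mpoly R[m.*2]}}.
Proof. exact: (frac_char0 R0). Qed.

Lemma Qgen_adj la k mu : Q (la ++ k :: k :: mu) = 0.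
Proof.
by apply: level_inj => m; rewrite levelQ Psum_adj ?frac2_neq0 // mulr0 rmorph0.
Qed.

(** A new row absorbs the factor 2 of the one-row function; raising a row keeps the length, so there
    the 2 remains as a coefficient. *)
Lemma Qgen_Pieri la : u 1%N = 0 ->
  Q [:: 1%N] * Q la = Q (rcons la 1%N) +
    \sum_(i < size la) (2%:R *: Q (incr_nth la i) + (2%:R * u (nth 0%N la i).+1) *: Q la).
Proof.
move=> u1; apply: level_inj => m; rewrite rmorphM rmorphD rmorph_sum /= !levelQ size_rcons /=.
rewrite mulrACA Psum_Pieri; last by rewrite u1 !rmorph0.
- rewrite -exprD add1n mulrDr; congr (_ + _); rewrite mulr_sumr; apply: eq_bigr => i _.
  rewrite rmorphD /= ![level m (_ *: Q _)]levelZ !levelQ size_incr_nth ltn_ord.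
  rewrite !rmorphM !rmorph_nat exprS /=; ring.
- exact: points_uniq.
- exact: (points_add_neq0 R0).
- exact: frac2_neq0.
Qed.

Lemma Qgen_expand k nu :
  Q (k :: nu) - Q [:: k] * Q nu =
  \sum_(j < size nu) (-1) ^+ j *
    (Q [:: k; nth 0%N nu j] - Q [:: k] * Q [:: nth 0%N nu j]) * Q (del nu j).
Proof.
apply: level_inj => m; rewrite rmorphB rmorphM rmorph_sum /= !levelQ /=.
rewrite mulrACA -exprD add1n -mulrBr Psum_expand; last first.
  exact: (points_add_neq0 R0).
rewrite mulr_sumr; apply: eq_bigr => j _; rewrite !rmorphM rmorphB rmorphXn rmorphN1 rmorphM /=.
rewrite !levelQ size_del //=; case: (size nu) j => [[]//|r] j /=.
by rewrite !exprS; ring.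
Qed.

Lemma Qgen_two_rows k l :
  Q [:: k; l.+1] + Q [:: k.+1; l] + (u k.+1 + u l.+1) *: Q [:: k; l] =
  Q [:: k] * Q [:: l.+1] - Q [:: k.+1] * Q [:: l]
  + (u l.+1 - u k.+1) *: (Q [:: k] * Q [:: l]).
Proof.
apply: level_inj => m; rewrite !(rmorphD, rmorphN, rmorphM) /=.
rewrite [level m (_ *: Q _)]levelZ [level m (_ *: (_ * _))]levelZ rmorphM /= !levelQ /=.
have := Psum_two_rows (fun k => tofrac (u k)%:MP) (points_add_neq0 R0 (N := m.*2)) k l.
rewrite !expr1 rmorphD rmorphB /= tofracD tofracB => E.
transitivity (2%:R ^+ 2 * (P m [:: k; l.+1] + P m [:: k.+1; l] +
   (tofrac (u k.+1)%:MP + tofrac (u l.+1)%:MP) * P m [:: k; l])); first by ring.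
by rewrite [X in _ * X]E; ring.
Qed.

End QIdentities.

(** * Specialization to the parameters (0, t_1, t_2, ...) *)

Section QFun.
Variable n : nat.
Local Notation Q := (Q_fun n).
Local Notation t := (tvar n).

Lemma Q_adj la k mu : Q (la ++ k :: k :: mu) = 0.
Proof. exact: Qgen_adj. Qed.

(** The zero inserted by [cons0] gives u_1 = 0 and shifts the indices, so that u_(k+1) is t_k; for k
    = 0 both are 0. *)
Lemma Q_Pieri la :
  Q [:: 1%N] * Q la = Q (rcons la 1%N) +
    \sum_(i < size la) (2%:R *: Q (incr_nth la i) + (2%:R * t (nth 0%N la i)) *: Q la).
Proof. exact: (@Qgen_Pieri _ (@Sq_char0 n) (cons0 t)). Qed.

Lemma Q_expand k nu :
  Q (k :: nu) - Q [:: k] * Q nu =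
  \sum_(j < size nu) (-1) ^+ j *
    (Q [:: k; nth 0%N nu j] - Q [:: k] * Q [:: nth 0%N nu j]) * Q (del nu j).
Proof. exact: Qgen_expand. Qed.

Lemma Q_two_rows k l :
  Q [:: k; l.+1] + Q [:: k.+1; l] + (t k + t l) *: Q [:: k; l] =
  Q [:: k] * Q [:: l.+1] - Q [:: k.+1] * Q [:: l] + (t l - t k) *: (Q [:: k] * Q [:: l]).
Proof. exact: (@Qgen_two_rows _ (@Sq_char0 n) (cons0 t)). Qed.

End QFun.

(** * Reduction modulo the ideal *)

Section SubalgebraIdeal.
Variables (R : comNzRingType) (A : comAlgType R) (G : seq A).
Local Notation B := (subalg G).

Lemma subalg1 : B 1.
Proof. by rewrite -[1]scale1r; apply: subalg_const. Qed.

Lemma subalgZ c x : B x -> B (c *: x).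
Proof. by move=> Bx; rewrite -mulr_algl; apply: subalg_mul => //; apply: subalg_const. Qed.

Lemma subalg0 : B 0.
Proof. by rewrite -(scale0r 1); apply: subalg_const. Qed.

Lemma subalgN x : B x -> B (- x).
Proof. by rewrite -scaleN1r; apply: subalgZ. Qed.

Lemma subalg_sign x j : B x -> B ((-1) ^+ j * x).
Proof. by rewrite -signr_odd mulr_sign; case: odd => // /subalgN. Qed.

Lemma subalg_sum (I : Type) (r : seq I) (p : pred I) (F : I -> A) :
  (forall i, p i -> B (F i)) -> B (\sum_(i <- r | p i) F i).
Proof. by move=> BF; elim/big_ind: _ => //; [exact: subalg0 | exact: subalg_add]. Qed.

Variable r : seq A.
Local Notation J := (gen_ideal B r).

Lemma gen_ideal0 : J 0.
Proof.
exists (fun=> 0) => [_|]; first exact: subalg0.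
by rewrite big1 // => i _; rewrite mul0r.
Qed.

Lemma gen_idealD x y : J x -> J y -> J (x + y).
Proof.
move=> [b Bb ->] [c Bc ->]; exists (fun i => b i + c i) => [i|]; first exact: subalg_add.
by rewrite -big_split; apply: eq_bigr => i _; rewrite mulrDl.
Qed.

Lemma gen_idealM x y : B x -> J y -> J (x * y).
Proof.
move=> Bx [b Bb ->]; exists (fun i => x * b i) => [i|]; first exact: subalg_mul.
by rewrite mulr_sumr; apply: eq_bigr => i _; rewrite mulrA.
Qed.

Lemma gen_idealZ c y : J y -> J (c *: y).
Proof. by move=> Jy; rewrite -mulr_algl; apply: gen_idealM => //; apply: subalg_const. Qed.

Lemma gen_idealN y : J y -> J (- y).
Proof. by rewrite -scaleN1r; apply: gen_idealZ. Qed.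

Lemma gen_ideal_gen x : x \in r -> J x.
Proof.
move=> xr; have ltx : (index x r < size r)%N by rewrite index_mem.
exists (fun i => if i == index x r then 1 else 0) => [i|].
  by case: eqP => _; [exact: subalg1 | exact: subalg0].
rewrite (bigD1 (Ordinal ltx)) //= eqxx mul1r nth_index // big1 ?addr0 // => i.
by rewrite -val_eqE /= => /negbTE ->; rewrite mul0r.
Qed.

Lemma gen_ideal_sum (I : Type) (s : seq I) (p : pred I) (F : I -> A) :
  (forall i, p i -> J (F i)) -> J (\sum_(i <- s | p i) F i).
Proof. by move=> JF; elim/big_ind: _ => //; [exact: gen_ideal0 | exact: gen_idealD]. Qed.

End SubalgebraIdeal.

(** * Strict partitions and adding a box *)

Lemma strict_cons k nu : strict_partition (k :: nu) =
  [&& (0 < k)%N, all (gtn k) nu & strict_partition nu].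
Proof.
rewrite /strict_partition /= inE negb_or eq_sym -lt0n path_sortedE; last first.
  by move=> x y z /=; lia.
by rewrite -!andbA; do !bool_congr.
Qed.

Lemma strict_del nu j : strict_partition nu -> strict_partition (del nu j).
Proof.
have sub : subseq (del nu j) nu.
  elim: nu j => [|k nu IH] [|j] //; first by rewrite /del take0 drop1 subseq_cons.
  by rewrite /= eqxx; apply: IH.
move=> /andP[s0 n0]; apply/andP; split; last by apply: contra n0; apply: mem_subseq.
by apply: (subseq_sorted _ sub s0) => x y z /=; lia.
Qed.

Lemma SP_cons n k nu : SP n (k :: nu) = strict_partition (k :: nu) && (k <= n)%N.
Proof. by []. Qed.

Lemma SP_all n la : SP n la = strict_partition la && all (fun k => (0 < k <= n)%N) la.
Proof.
case: la => [|k nu] //=; rewrite SP_cons strict_cons.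
case: (posnP k) => //= k0; case: (boolP (all _ nu)) => //= lt_nu.
case: (boolP (strict_partition nu)) => //= /andP[_ n0].
case: leqP => //= le_kn; apply/esym/allP => x xnu; have /= := allP lt_nu x xnu.
by have : x != 0%N by [apply: contraNneq n0 => <-]; lia.
Qed.

Lemma SP_bounded n la : strict_partition la -> {in la, forall k, (k <= n)%N} -> SP n la.
Proof. by rewrite /SP => ->; case: la => // k nu; apply; apply: mem_head. Qed.

Lemma incr_nth_size la : incr_nth la (size la) = rcons la 1%N.
Proof. by elim: la => //= k la ->. Qed.

(** A box added to a row can break strictness only by making that row equal to the previous one;
    [Q_adj] kills such shapes. *)
Lemma incr_nth_not_strict la i : strict_partition la -> (i <= size la)%N ->
    ~~ strict_partition (incr_nth la i) ->
  exists mu k nu, incr_nth la i = mu ++ k :: k :: nu.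
Proof.
elim: la i => [|k la IH] [|i] //=.
  rewrite !strict_cons => /and3P[_ lt_la ->] _; rewrite andbT /= => /negP[].
  by apply: sub_all lt_la => x /=; lia.
move=> sla le_i; case: (boolP (strict_partition (incr_nth la i))) => si; last first.
  move: sla; rewrite strict_cons => /and3P[_ _ sla] _.
  by have [mu [l [nu ->]]] := IH i sla le_i si; exists (k :: mu), l, nu.
move: sla; rewrite !strict_cons si => /and3P[k0 lt_la sla]; rewrite k0 andbT /=.
(* The tail stays strict, so the failure lies between the first two rows, which forces the box into
   the second row. *)
case: i le_i si => [_|i le_i] si.
  case: la lt_la sla {IH} si => [|l la] /=.
    by move=> _ _ _; rewrite andbT => ?; exists [::], k, [::]; congr [:: _; _]; lia.
  move=> /andP[lt_l lt_la] sla sl; rewrite lt_la andbT => nl.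
  by exists [::], k, la; congr [:: _, _ & _]; lia.
case: la lt_la sla IH le_i si => [|l la] //= /andP[lt_l lt_la] sla _ _.
rewrite lt_l strict_cons /= => /and3P[l0 li _] /negP[].
by apply: sub_all li => x /=; lia.
Qed.

(** * Membership in the ring and the quantum relation *)

Section QuantumRelations.
Local Arguments tvar : simpl never.
Variables (n : nat) (n_gt0 : (0 < n)%N).
Local Notation Q := (Q_fun n).
Local Notation t := (tvar n).
Local Notation B := (Qring n).
Local Notation J := (gen_ideal (Qring n) (Jgens n)).

Lemma Qring_low k : (0 < k <= n)%N -> B (Q [:: k]).
Proof.
move=> k_n; apply: subalg_gen; rewrite mem_cat; apply/orP; left.
by apply: map_f; rewrite mem_iota; lia.
Qed.

Lemma Qring_high k : (n.+1 < k <= n.*2)%N -> B (Q [:: k]).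
Proof.
move=> k_n; apply: subalg_gen; rewrite mem_cat inE; apply/orP; right; apply/orP; right.
by apply: map_f; rewrite mem_iota; lia.
Qed.

Lemma Qring_double k : (0 < k <= n.*2)%N -> B (2%:R *: Q [:: k]).
Proof.
move=> k_n; case: (ltngtP k n.+1) => [?|?|->]; last first.
- by apply: subalg_gen; rewrite mem_cat !inE eqxx orbT.
- by apply: subalgZ; apply: Qring_high; lia.
- by apply: subalgZ; apply: Qring_low; lia.
Qed.

Lemma J_high k : (n.+1 < k <= n.*2)%N -> J (Q [:: k]).
Proof.
move=> k_n; apply: gen_ideal_gen; rewrite inE; apply/orP; right.
by apply: map_f; rewrite mem_iota; lia.
Qed.

Definition Zrow k l := Q [:: k; l] - Q [:: k] * Q [:: l].

(** The Pieri rule for the one-row shape k. *)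
Lemma Zrow1 k : Zrow k 1 = - (2%:R *: Q [:: k.+1]) - t k *: (2%:R *: Q [:: k]).
Proof.
have := Q_Pieri n [:: k]; rewrite big_ord1 /= /Zrow mulrC => ->.
by rewrite (scalerA (t k) 2%:R) [t k * _]mulrC opprD addrA subrr add0r opprD.
Qed.

Lemma ZrowS k l : Zrow k l.+1 =
  - Zrow k.+1 l - (t k + t l) *: Zrow k l - (2%:R *: Q [:: k.+1]) * Q [:: l]
  - t k *: ((2%:R *: Q [:: k]) * Q [:: l]).
Proof.
(* [Q_two_rows] is solved for the correction over abstract elements; [mulr_algl] turns scalars into
   factors so that [ring] applies. *)
have Zrec (A : comAlgType (Sq n)) (p1 p2 p3 q1 q2 q3 q4 : A) a b :
    p1 + p2 + (a + b) *: p3 = q1 * q2 - q3 * q4 + (b - a) *: (q1 * q4) ->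
  p1 - q1 * q2 = - (p2 - q3 * q4) - (a + b) *: (p3 - q1 * q4)
    - (2%:R *: q3) * q4 - a *: ((2%:R *: q1) * q4).
  rewrite -(mulr_algl _ p3) -(mulr_algl _ (p3 - _)) -(mulr_algl _ q3) -(mulr_algl _ q1).
  rewrite -(mulr_algl _ (q1 * q4)) -(mulr_algl _ (_ * q1 * q4)) scaler_nat scalerDl scalerBl => E.
  by rewrite -[p1](addrK p2) -[p1 + p2](addrK ((a%:A + b%:A) * p3)) E; ring.
exact: Zrec (Q_two_rows n k l).
Qed.

(** Induction on l: the recursion brings in only 2 Q_j with j <= k + l and Q_j with j < l, all in
    the ring under these bounds. *)
Lemma Qring_Zrow k l : (0 < k)%N -> (0 < l <= n)%N -> (k + l <= n.*2)%N -> B (Zrow k l).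
Proof.
case: l => // l k0 /=; elim: l k k0 => [|l IH] k k0 le_l le_kl.
  rewrite Zrow1; apply: subalg_add; apply: subalgN; last apply: subalgZ.
    by apply: Qring_double; lia.
  by apply: Qring_double; lia.
have BQ j : (0 < j <= k.+1)%N -> B ((2%:R *: Q [:: j]) * Q [:: l.+1]).
  by move=> j_k; apply: subalg_mul; [apply: Qring_double; lia | apply: Qring_low; lia].
rewrite ZrowS; apply: subalg_add; [apply: subalg_add; [apply: subalg_add|]|]; apply: subalgN.
- by apply: IH; lia.
- by apply: subalgZ; apply: IH; lia.
- by apply: BQ; lia.
- by apply: subalgZ; apply: BQ; lia.
Qed.

(* The factor t_k of the terms in Q_k vanishes since k > n. *)
Lemma J_Zrow k l : (n < k)%N -> (0 < l)%N -> (k + l <= n.*2)%N -> J (Zrow k l).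
Proof.
have t0 j : (n < j)%N -> t j = 0.
  by case: j => // j lt_j; rewrite /tvar insubF //; lia.
case: l => // l lt_k _; elim: l k lt_k => [|l IH] k lt_k le_kl.
  rewrite Zrow1 t0 // scale0r subr0; apply: gen_idealN; apply: gen_idealZ.
  by apply: J_high; lia.
rewrite ZrowS t0 // scale0r subr0 add0r.
apply: gen_idealD; [apply: gen_idealD|]; apply: gen_idealN.
- by apply: IH; lia.
- by apply: gen_idealZ; apply: IH; lia.
- rewrite mulrC; apply: gen_idealM; first by apply: Qring_low; lia.
  by apply: gen_idealZ; apply: J_high; lia.
Qed.

(** Induction on the length by [Q_expand]; strictness gives nu_j < k <= n, hence the bound k + nu_j
    <= 2n of [Qring_Zrow]. *)
Lemma Qring_SP la : SP n la -> B (Q la).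
Proof.
have [m] := ubnP (size la); elim: m la => // m IH [|k nu] /=.
  by move=> _ _; rewrite Q_fun_nil; apply: subalg1.
rewrite ltnS => le_m; rewrite SP_cons strict_cons => /andP[/and3P[k0 lt_nu s_nu] le_kn].
have SPn mu : {subset mu <= nu} -> strict_partition mu -> SP n mu.
  move=> mu_nu smu; apply: SP_bounded => // x /mu_nu /(allP lt_nu) /=; lia.
rewrite -[Q _](subrK (Q [:: k] * Q nu)) Q_expand; apply: subalg_add; last first.
  apply: subalg_mul; first by apply: Qring_low; rewrite k0.
  by apply: IH => //; apply: SPn.
apply: subalg_sum => j _; apply: subalg_mul.
  apply: subalg_sign; apply: Qring_Zrow => //.
    by have := SPn nu (fun=> id) s_nu; rewrite SP_all => /andP[_ /allP]; apply; apply: mem_nth.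
  have := allP lt_nu _ (mem_nth 0%N (ltn_ord j)); rewrite /=; lia.
apply: IH; first by rewrite size_del //; have := ltn_ord j; lia.
by apply: SPn (strict_del _ s_nu); apply: mem_del.
Qed.

(** Strictness gives nu_j < n, so (n + 1) + nu_j <= 2n and all corrections in [Q_expand] lie in the
    ideal; what remains is a multiple of the generator 2 Q_(n+1) - q. *)
Lemma J_corner nu : strict_partition (n :: nu) ->
  J (2%:R *: Q (n.+1 :: nu) - qvar n *: Q nu).
Proof.
rewrite strict_cons => /and3P[_ lt_nu s_nu].
have SPn mu : {subset mu <= nu} -> strict_partition mu -> SP n mu.
  move=> mu_nu smu; apply: SP_bounded => // x /mu_nu /(allP lt_nu) /=; lia.
have splitE (A : comAlgType (Sq n)) c d (x y z : A) :
    c *: x - d *: z = z * (c *: y - d%:A) + c *: (x - y * z).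
  by rewrite mulrBr scalerBr -!scalerAr mulr1 [z * y]mulrC [RHS]addrC subrKA.
rewrite (splitE _ _ _ _ (Q [:: n.+1])).
apply: gen_idealD.
  apply: gen_idealM; first by apply: Qring_SP; apply: SPn.
  by apply: gen_ideal_gen; rewrite inE eqxx.
rewrite Q_expand; apply: gen_idealZ; apply: gen_ideal_sum => j _; rewrite mulrC.
apply: gen_idealM.
  by apply: Qring_SP; apply: SPn (strict_del _ s_nu); apply: mem_del.
apply: gen_idealM; first by rewrite -[(-1) ^+ j]mulr1; apply: subalg_sign; apply: subalg1.
have jnu := mem_nth 0%N (ltn_ord j).
apply: J_Zrow => //; last by have := allP lt_nu _ jnu; rewrite /=; lia.
by have := SPn nu (fun=> id) s_nu; rewrite SP_all => /andP[_ /allP/(_ _ jnu)/andP[]].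
Qed.

(** The new row is the case i = [size la], where the exponent of 2 is 0; it is 1 for the other i. *)
Lemma Q_Pieri_sum la :
  Q [:: 1%N] * Q la =
  \sum_(i < (size la).+1)
     2%:R ^+ ((size la).+1 - size (incr_nth la i)) *: Q (incr_nth la i)
  + (2%:R * \sum_(k <- la) t k) *: Q la.
Proof.
rewrite Q_Pieri big_split big_ord_recr /= incr_nth_size size_rcons subnn expr0 scale1r.
rewrite addrA [X in X + _]addrC; congr (_ + _ + _).
  by apply: eq_bigr => i _; rewrite size_incr_nth ltn_ord subSnn expr1.
rewrite (big_nth 0%N) big_mkord mulr_sumr scaler_suml.
by apply: eq_bigr.
Qed.

End QuantumRelations.

(** * The quantum Pieri congruence *)

Theorem theorem5p1 (n : nat) (n_gt0 : (0 < n)%N) (la : seq nat)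
    (la_SP : SP n la) :
  congr_ideal (Qring n) (Jgens n)
    (Q_fun n [:: 1%N] * Q_fun n la)
    (\sum_(i < (size la).+1 | SP n (incr_nth la i))
        (2%:R ^+ ((size la).+1 - size (incr_nth la i)) *:
           Q_fun n (incr_nth la i))
     + (2%:R * \sum_(k <- la) tvar n k) *: Q_fun n la
     + (if head 0%N la == n then qvar n *: Q_fun n (behead la) else 0)).
Proof.
have s_la : strict_partition la by case/andP: la_SP.
have BQ := Qring_SP n_gt0 la_SP.
split.
- by apply: subalg_mul => //; apply: Qring_low; rewrite n_gt0.
- apply: subalg_add; [apply: subalg_add|].
  + by apply: subalg_sum => i SPi; apply: subalgZ; apply: Qring_SP.
  + exact: subalgZ.
  + case: eqP => [E|_]; last exact: subalg0.
    apply: subalgZ; apply: Qring_SP => //; case: la la_SP {s_la BQ} E => // k nu.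
    rewrite !SP_all strict_cons /= => /andP[/and3P[_ _ ->]] /andP[_ ->] _ //.
rewrite Q_Pieri_sum (bigID (fun i : 'I_ _ => SP n (incr_nth la i))) /=.
(* The shapes in SP(n) and the t-terms cancel; what remains is the sum over the shapes outside SP(n)
   minus the quantum term. *)
have -> : forall x y z w : plim (Sq n), x + y + z - (x + z + w) = y - w.
  by move=> x y z w; ring.
(* A shape outside SP(n) is either not strict, and its Q-function vanishes, or has first row n + 1,
   which needs i = 0 and la_1 = n. *)
have Q0 (i : 'I_(size la).+1) : ~~ SP n (incr_nth la i) ->
    (i != ord0) || (head 0%N la != n) -> Q_fun n (incr_nth la i) = 0.
  move=> nSP ni; have : ~~ strict_partition (incr_nth la i).
    apply: contra nSP => si; rewrite /SP si /=; case/andP: la_SP => _.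
    case: i ni {si} => [[|i] lt_i]; case: la {s_la BQ} lt_i => //= k nu; lia.
  case/(incr_nth_not_strict s_la); first by rewrite -ltnS.
  by move=> mu [k [nu ->]]; apply: Q_adj.
case: (head 0%N la =P n) => [E|/eqP nE]; last first.
  rewrite subr0 big1; first exact: gen_ideal0.
  by move=> i nSP; rewrite Q0 ?scaler0 // nE orbT.
(* For the empty partition the head defaults to 0, which would force n = 0. *)
case: la s_la la_SP E Q0 {BQ} => [|k nu] s_la la_SP /= E Q0.
  by rewrite -E in n_gt0.
rewrite {k}E in s_la la_SP Q0 *.
(* The shape (n + 1, nu), from i = 0, is the only one left; [J_corner] matches it with the quantum
   term. *)
rewrite (bigD1 ord0) /=; last by rewrite SP_cons ltnn andbF.
rewrite big1 ?addr0 => [|i /andP[nSP ni]]; last by rewrite (Q0 i) ?ni ?scaler0.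
by rewrite subSnn expr1; apply: J_corner.
Qed.
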